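(* Let $m\in\mathbb N$ and let $I:(0,1]\to(0,\infty)$ be nondecreasing with $\inf_{t\in(0,1]}I(t)/t>0$. Let $\|\cdot\|_{X(0,1)}$ be a rearrangement-invariant norm with fundamental function $\varphi_X$. (a) The following are equivalent: (i) $\lim_{a\to0_+}\sup_{\|f\|_{L^1(0,1)}\le1}\|H^m_I(\chi_{(0,a)}f)\|_{X(0,1)}=0$; (ii) $\lim_{a\to0_+}\sup_{\|f\|_{L^1(0,1)}\le1}\|K^m_I(\chi_{(0,a)}f)\|_{X(0,1)}=0$; (iii) $\lim_{a\to0_+}\frac{a^{m-1}\varphi_X(a)}{(I(a))^m}=0$. (b) The following are equivalent: (i) $\lim_{a\to0_+}\sup_{\|f\|_{X(0,1)}\le1}\|H^m_I(\chi_{(0,a)}f)\|_{L^1(0,1)}=0$; (ii) $\lim_{a\to0_+}\sup_{\|f\|_{X(0,1)}\le1}\|K^m_I(\chi_{(0,a)}f)\|_{L^1(0,1)}=0$. If $X(0,1)\ne L^1(0,1)$, then both (i) and (ii) hold; if $X(0,1)=L^1(0,1)$, then (i) and (ii) hold if and only if $\lim_{s\to0_+}\frac{s}{I(s)}=0$.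
   Context: A rearrangement-invariant (r.i.) norm on $(0,1)$ is a functional $\|\cdot\|_{X(0,1)}$ on measurable functions with values in $[0,\infty]$ satisfying: for $f,g\ge0$, $a\ge0$, $\|f\|=0$ iff $f=0$ a.e., $\|af\|=a\|f\|$, $\|f+g\|\le\|f\|+\|g\|$; $f\le g$ a.e. $\Rightarrow\|f\|\le\|g\|$; $0\le f_k\uparrow f$ a.e. $\Rightarrow\|f_k\|\uparrow\|f\|$; $\|1\|<\infty$; $\int_0^1f\le C\|f\|$; equimeasurable functions have equal norm. Its fundamental function is $\varphi_X(t)=\|\chi_{(0,t)}\|_{X(0,1)}$. $X(0,1)=L^1(0,1)$ means equality as sets. Operators: $H^m_If(t)=\frac{1}{(m-1)!}\int_t^1\frac{|f(s)|}{I(s)}\big(\int_t^s\frac{dr}{I(r)}\big)^{m-1}ds$ and $K^m_If(t)=\int_t^1|f(s)|\frac{s^{m-1}}{(I(s))^m}ds$, $t\in(0,1)$. *)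

(* Defs.v *)
From HB Require Import structures.
From mathcomp Require Import all_boot all_order all_algebra.
From mathcomp Require Import all_classical all_reals all_analysis measurable_realfun.
Set Implicit Arguments. Unset Strict Implicit. Unset Printing Implicit Defensive.
Import Order.TTheory GRing.Theory Num.Theory.
Import numFieldNormedType.Exports.
Local Open Scope classical_set_scope.
Local Open Scope ring_scope.

Section Defs.
Variable R : realType.

Local Notation leb := (@lebesgue_measure R).

Definition I01 : set R := `]0, 1[.

Definition mpos (f : R -> \bar R) : Prop :=
  measurable_fun I01 f /\ (forall x, (0 <= f x)%E).

(* A rearrangement-invariant norm on (0,1), given (as in Bennett--Sharpley)
   by its values rho f on nonnegative measurable functions f;
   for a general measurable f, ||f||_X := rho |f|. *)
Record ri_norm (rho : (R -> \bar R) -> \bar R) : Prop := {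
  ri_ge0 : forall f, mpos f -> (0 <= rho f)%E;
  ri_eq0 : forall f, mpos f ->
    (rho f = 0%E <-> {ae leb, forall x, I01 x -> f x = 0%E});
  ri_homog : forall f (a : R), mpos f -> 0 <= a ->
    rho (fun x => (a%:E * f x)%E) = (a%:E * rho f)%E;
  ri_triangle : forall f g, mpos f -> mpos g ->
    (rho (fun x => f x + g x) <= rho f + rho g)%E;
  ri_lattice : forall f g, mpos f -> mpos g ->
    {ae leb, forall x, I01 x -> (f x <= g x)%E} -> (rho f <= rho g)%E;
  ri_fatou : forall (fk : nat -> R -> \bar R) f,
    (forall k, mpos (fk k)) -> mpos f ->
    {ae leb, forall x, I01 x ->
       (forall k, (fk k x <= fk k.+1 x)%E) /\ ((fun k => fk k x) @ \oo --> f x)} ->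
    (fun k => rho (fk k)) @ \oo --> rho f;
  ri_one : (rho (fun _ => 1%E) < +oo)%E;
  ri_L1 : exists C : R, forall f, mpos f ->
    (\int[leb]_(x in I01) f x <= C%:E * rho f)%E;
  ri_rearr : forall f g, mpos f -> mpos g ->
    (forall l : R, leb (I01 `&` [set x | (l%:E < f x)%E])
                 = leb (I01 `&` [set x | (l%:E < g x)%E])) ->
    rho f = rho g
}.

Definition fundfun (rho : (R -> \bar R) -> \bar R) (t : R) : \bar R :=
  rho (fun x => (\1_(`]0, t[ : set R) x)%:E).

(* X(0,1) = L^1(0,1) as sets of (real-valued, measurable) functions *)
Definition X_is_L1 (rho : (R -> \bar R) -> \bar R) : Prop :=
  forall f : R -> R, measurable_fun I01 f ->
    ((rho (fun x => `|f x|%:E) < +oo)%E <->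
     (\int[leb]_(x in I01) `|f x|%:E < +oo)%E).

Definition Hop (m : nat) (I : R -> R) (f : R -> R) (t : R) : \bar R :=
  (if ((0 < t) && (t < 1))%R then
    ((m.-1)`!%:R^-1)%R%:E *
      \int[leb]_(s in `]t, 1%R[) ((`|f s| / I s)%R%:E *
           (\int[leb]_(r in `]t, s[) ((I r)^-1)%R%:E) ^+ m.-1)
  else 0)%E.

Definition Kop (m : nat) (I : R -> R) (f : R -> R) (t : R) : \bar R :=
  (if ((0 < t) && (t < 1))%R then
    \int[leb]_(s in `]t, 1%R[) (`|f s| * s ^+ m.-1 / (I s) ^+ m)%R%:E
  else 0)%E.

Definition restr (a : R) (f : R -> R) : R -> R :=
  fun x => \1_(`]0, a[ : set R) x * f x.

Definition L1ball : set (R -> R) :=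
  [set f : R -> R | measurable_fun I01 f /\ (\int[leb]_(x in I01) `|f x|%:E <= 1)%E].
Definition Xball (rho : (R -> \bar R) -> \bar R) : set (R -> R) :=
  [set f : R -> R | measurable_fun I01 f /\ (rho (fun x => `|f x|%:E) <= 1)%E].

Definition L1norm (g : R -> \bar R) : \bar R := \int[leb]_(x in I01) abse (g x).

End Defs.

(* Main.v *)
(* Both operators have the form [f |-> \int_t^1 |f s| Ker t s ds], and the heart of
   the matter is an upper bound for their kernels.  Write [phi] for the fundamental
   function, and suppose [s^(m-1) phi s <= eps (I s)^m] for [s < a].  Extracting
   m-th roots, [1 / I s <= eps^(1/m) s^(1/m - 1) (phi s)^(-1/m)]; integrating this
   bound over [(t, s)], where [phi >= phi t], gives for both kernels
     [Ker t s <= C eps (phi t)^(-(m-1)/m) (phi s)^(-1/m)]   for [t < s < a],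
   the powers of [s] having cancelled.  Cutting (0,1) along the level sets
   [phi <= 2^(-mk) phi 1], whose indicators have norm at most [2^(-mk) phi 1],
   turns this into a geometric series, and the norm of the operator from L^1 is at
   most [C eps].  Powers of 2 attached to the level sets replace the m-th roots.
   The converse in (a) is obtained by testing on multiples of the indicator of
   [(a/2, a)].

   The estimate only uses lattice properties of the norm, so it applies to L^1
   itself, where [phi s = s]; it then bounds the L^1 norm of the operators by
   [C (sup_(s<a) s / I s)^m \int_0^a |f|].  For (b) it remains to see that
   [\int_0^a |f|] tends to 0 uniformly on the unit ball of X unless X = L^1.
   Averaging over cyclic permutations of equal cells of (0,a) gives
   [\int_0^a |f| <= a / phi a] on the unit ball, so if the limit is not 0 then
   [phi t <= C t] and every integrable function is in X. *)
Require Import Defs.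
From HB Require Import structures.
From mathcomp Require Import all_boot all_order all_algebra.
From mathcomp Require Import all_classical all_reals all_analysis measurable_realfun.
From mathcomp Require Import ring lra zify.
Import Order.TTheory GRing.Theory Num.Theory.
Import numFieldNormedType.Exports.
Local Open Scope classical_set_scope.
Local Open Scope ring_scope.
Set Implicit Arguments. Unset Strict Implicit. Unset Printing Implicit Defensive.

(** * Limits at 0 from the right, and measurability of nonnegative functions on (0,1) *)

Section Basics.
Context {R : realType}.
Local Notation leb := (@lebesgue_measure R).
Local Notation I01 := (@I01 R).
Implicit Types (f g : R -> \bar R) (t a e : R).

Lemma I01E t : I01 t <-> 0 < t < 1.
Proof. by rewrite /Defs.I01 /= in_itv. Qed.

Lemma measurable_I01 : measurable I01.
Proof. exact: measurable_itv. Qed.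
Hint Resolve measurable_I01 : core.

(** The sign of [F] is known on (0,1) only, so [d] is capped at 1: every [a < d] then lies where [F]
    is nonnegative. *)
Lemma cvg_at_right0P (F : R -> \bar R) :
  (forall a, 0 < a < 1 -> (0 <= F a)%E) ->
  F @ 0^'+ --> 0%E <->
  (forall e, 0 < e -> exists2 d, 0 < d <= 1 & forall a, 0 < a < d -> (F a <= e%:E)%E).
Proof.
move=> F0; split.
  move=> /fine_cvgP[Ffin /cvgrPdist_le cF] e e0.
  have [d1 /= d10 h1] := Ffin; have [d2 /= d20 h2] := cF _ e0.
  exists (Num.min 1 (Num.min d1 d2)).
    by rewrite !lt_min ltr01 d10 d20 /= ge_min lexx.
  move=> a /andP[a0]; rewrite !lt_min => /and3P[a1 ad1 ad2].
  have := h1 a; rewrite /ball /= sub0r normrN gtr0_norm// => /(_ ad1 a0) fa.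
  have := h2 a; rewrite /ball /= sub0r normrN gtr0_norm// => /(_ ad2 a0).
  rewrite sub0r normrN ger0_norm ?fine_ge0 ?F0 ?a0// => Fe.
  by rewrite -(fineK fa) lee_fin.
move=> H; apply/fine_cvgP; split.
  have [d /andP[d0 d1] Hd] := H _ ltr01; exists d => //= a.
  rewrite /ball /= sub0r normrN => /ltr_normlW ad a0.
  rewrite ge0_fin_numE ?F0 ?a0 ?(lt_le_trans ad)//.
  by apply: le_lt_trans (ltry 1); apply: Hd; rewrite a0.
apply/cvgrPdist_le => e e0.
have [d /andP[d0 d1] Hd] := H _ e0; exists d => //= a.
rewrite /ball /= sub0r normrN => /ltr_normlW ad a0.
have Fa0 : (0 <= F a)%E by rewrite F0 ?a0 ?(lt_le_trans ad).
have Fae : (F a <= e%:E)%E by rewrite Hd ?a0.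
rewrite sub0r normrN ger0_norm ?fine_ge0//.
by rewrite -lee_fin fineK// ge0_fin_numE// (le_lt_trans Fae) ?ltry.
Qed.

Lemma cvgr_at_right0P (F : R -> R) :
  (forall a, 0 < a < 1 -> 0 <= F a) ->
  F @ 0^'+ --> 0 <->
  (forall e, 0 < e -> exists2 d, 0 < d <= 1 & forall a, 0 < a < d -> F a <= e).
Proof.
move=> F0; split.
  move=> /cvgrPdist_le cF e e0; have [d /= d0 h] := cF _ e0.
  exists (Num.min 1 d); first by rewrite !lt_min ltr01 d0 /= ge_min lexx.
  move=> a /andP[a0]; rewrite !lt_min => /andP[a1 ad].
  have := h a; rewrite /ball /= sub0r normrN gtr0_norm// => /(_ ad a0).
  by rewrite sub0r normrN ger0_norm// F0 ?a0.
move=> H; apply/cvgrPdist_le => e e0.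
have [d /andP[d0 d1] Hd] := H _ e0; exists d => //= a.
rewrite /ball /= sub0r normrN => /ltr_normlW ad a0.
by rewrite sub0r normrN ger0_norm ?Hd ?a0// F0 ?a0 ?(lt_le_trans ad).
Qed.

(** The superlevel sets are intervals. Measurability of [1 / I] and of the images of the operators
    is obtained in this way. *)
Lemma measurable_fun_nonincreasing (D : set R) f : is_interval D ->
  (forall x y, D x -> D y -> x <= y -> (f y <= f x)%E) -> measurable_fun D f.
Proof.
move=> iD fni mD.
apply: (measurability _ (ErealGenOInfty.measurableE R)) => // _ [_ [r ->] <-].
apply: is_interval_measurable => x y /= [Dx fx] [Dy fy] z xzy.
have Dz := iD x y Dx Dy z xzy; split => //.
move: fy; rewrite !in_itv /= !andbT => fy.
by apply: lt_le_trans fy _; apply: fni => //; case/andP: xzy.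
Qed.

Lemma measurable_fun_nondecreasing (D : set R) f : is_interval D ->
  (forall x y, D x -> D y -> x <= y -> (f x <= f y)%E) -> measurable_fun D f.
Proof.
move=> iD fni mD.
apply: (measurability _ (ErealGenOInfty.measurableE R)) => // _ [_ [r ->] <-].
apply: is_interval_measurable => x y /= [Dx fx] [Dy fy] z xzy.
have Dz := iD x y Dx Dy z xzy; split => //.
move: fx; rewrite !in_itv /= !andbT => fx.
by apply: lt_le_trans fx _; apply: fni => //; case/andP: xzy.
Qed.

Lemma mpos_nonincreasing f : (forall x, 0 <= f x)%E ->
  (forall x y, 0 < x -> x <= y -> y < 1 -> (f y <= f x)%E) -> mpos f.
Proof.
move=> f0 fni; split => //; apply: measurable_fun_nonincreasing.
  exact: interval_is_interval.
move=> x y /I01E/andP[x0 _] /I01E/andP[_ y1] xy; exact: fni.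
Qed.

Lemma mposD f g : mpos f -> mpos g -> mpos (fun x => f x + g x)%E.
Proof.
move=> [mf f0] [mg g0]; split; first exact: emeasurable_funD.
by move=> x; rewrite adde_ge0.
Qed.

Lemma mposZ f a : 0 <= a -> mpos f -> mpos (fun x => a%:E * f x)%E.
Proof.
move=> a0 [mf f0]; split; first exact: measurable_funeM.
by move=> x; rewrite mule_ge0.
Qed.

Lemma mpos_EFin (f : R -> R) : measurable_fun I01 f -> (forall x, 0 <= f x) ->
  mpos (fun x => (f x)%:E).
Proof.
by move=> mf f0; split; [exact/measurable_EFinP|move=> x; rewrite lee_fin].
Qed.

Lemma mpos_abs (f : R -> R) : measurable_fun I01 f -> mpos (fun x => `|f x|%:E).
Proof. by move=> mf; apply: mpos_EFin => //; exact: measurableT_comp. Qed.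

Lemma mpos_indic (A : set R) : measurable A -> mpos (fun x => (\1_A x)%:E).
Proof. by move=> mA; apply: mpos_EFin => //; exact: measurable_indic. Qed.

Lemma mpos_sum (n : nat) (h : nat -> R -> \bar R) :
  (forall k, mpos (h k)) -> mpos (fun x => \sum_(k < n) h k x)%E.
Proof.
move=> mh; split; first by apply: emeasurable_sum => k; case: (mh k).
by move=> x; apply: sume_ge0 => k _; case: (mh k).
Qed.

Lemma mpos_mulindic f (A : set R) : mpos f -> measurable A ->
  mpos (fun x => f x * (\1_A x)%:E)%E.
Proof.
move=> [mf f0] mA; split; last by move=> x; rewrite mule_ge0 ?lee_fin.
by apply: emeasurable_funM => //; case: (mpos_indic mA).
Qed.

Lemma ae_I01W (P : R -> Prop) :
  (forall x, 0 < x < 1 -> P x) -> {ae leb, forall x, I01 x -> P x}.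
Proof. by move=> H; apply: aeW => x /I01E; exact: H. Qed.

End Basics.
#[global] Hint Extern 0 (measurable _) => solve [exact: measurable_I01] : core.

(** * Lattice norms and the norm of an indicator *)

Section LatticeNorm.
Context {R : realType}.
Local Notation leb := (@lebesgue_measure R).
Local Notation I01 := (@I01 R).

(* The part of the structure of an r.i. norm that the upper bounds use; [L1norm]
   has it too, so that one estimate serves both halves of the theorem. *)
Record lattice_norm (rho : (R -> \bar R) -> \bar R) : Prop := {
  ln_ge0 : forall f, mpos f -> (0 <= rho f)%E;
  ln_homog : forall f (a : R), mpos f -> 0 <= a ->
    rho (fun x => (a%:E * f x)%E) = (a%:E * rho f)%E;
  ln_triangle : forall f g, mpos f -> mpos g ->
    (rho (fun x => f x + g x) <= rho f + rho g)%E;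
  ln_lattice : forall f g, mpos f -> mpos g ->
    {ae leb, forall x, I01 x -> (f x <= g x)%E} -> (rho f <= rho g)%E;
  ln_fatou : forall (fk : nat -> R -> \bar R) f,
    (forall k, mpos (fk k)) -> mpos f ->
    (forall x, 0 < x < 1 ->
       (forall k, (fk k x <= fk k.+1 x)%E) /\ ((fun k => fk k x) @ \oo --> f x)) ->
    (fun k => rho (fk k)) @ \oo --> rho f;
  ln_one : (rho (fun _ => 1%E) < +oo)%E;
  ln_fund_gt0 : forall t, 0 < t < 1 -> (0 < fundfun rho t)%E }.

Lemma lebesgue_measure_itvE (b1 b2 : bool) (x y : R) : x <= y ->
  leb [set` Interval (BSide b1 x) (BSide b2 y)] = (y - x)%:E.
Proof.
rewrite le_eqVlt => /orP[/eqP<-|xy]; rewrite lebesgue_measure_itv /= lte_fin.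
  by rewrite ltxx subrr.
by rewrite xy EFinB.
Qed.

Lemma L1normE (f : R -> \bar R) : (forall x, 0 < x < 1 -> (0 <= f x)%E) ->
  L1norm f = (\int[leb]_(x in I01) f x)%E.
Proof.
by move=> f0; apply: eq_integral => x /set_mem/I01E x01; rewrite gee0_abs ?f0.
Qed.

Lemma fundfun_L1norm (t : R) : 0 <= t <= 1 -> fundfun (@L1norm R) t = t%:E.
Proof.
move=> /andP[t0 t1].
rewrite /fundfun L1normE; last by move=> x _; rewrite lee_fin.
rewrite integral_indic////.
rewrite setIidl; first by rewrite [LHS]lebesgue_measure_itvE// subr0.
move=> x xt; apply/I01E; move: xt; rewrite /= in_itv /= => /andP[-> xt].
by rewrite (lt_le_trans xt).
Qed.

Lemma L1norm_lattice_norm : lattice_norm (@L1norm R).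
Proof.
split.
- by move=> f mf; apply: integral_ge0.
- move=> f a [mf f0] a0; rewrite L1normE => [|x _]; last by rewrite mule_ge0.
  by rewrite L1normE// ge0_integralZl_EFin//.
- move=> f g [mf f0] [mg g0]; rewrite L1normE => [|x _]; last by rewrite adde_ge0.
  by rewrite !L1normE// ge0_integralD//.
- move=> f g [mf f0] [mg g0] fg; rewrite !L1normE//.
  by apply: ae_ge0_le_integral => //.
- move=> fk f mfk [mf f0] cf.
  rewrite L1normE// (_ : (fun k => _) = (fun k => \int[leb]_(x in I01) fk k x)%E);
    last by apply/funext => k; rewrite L1normE// => x _; case: (mfk k).
  have -> : (\int[leb]_(x in I01) f x = \int[leb]_(x in I01) limn (fk ^~ x))%E.
    by apply: eq_integral => x /set_mem/I01E x01; have [_ /cvg_lim ->] := cf _ x01.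
  apply: cvg_monotone_convergence => //.
  + by move=> n; case: (mfk n).
  + by move=> n x _; case: (mfk n).
  + by move=> x /I01E x01; apply/nondecreasing_seqP => n; have [] := cf _ x01.
- rewrite L1normE// integral_cst ?mul1e//.
  by rewrite [ltLHS]lebesgue_measure_itvE ?ltry.
- by move=> t /andP[t0 t1]; rewrite fundfun_L1norm ?lte_fin// !ltW.
Qed.

Lemma ri_norm_lattice_norm (rho : (R -> \bar R) -> \bar R) :
  ri_norm rho -> lattice_norm rho.
Proof.
move=> rn; split; try by case: rn.
  move=> fk f mfk mf cf; apply: (ri_fatou rn) => //; exact: ae_I01W.
move=> t /andP[t0 t1]; rewrite lt0e; apply/andP; split; last first.
  by apply: (ri_ge0 rn); exact: mpos_indic.
apply/eqP => /(ri_eq0 rn (mpos_indic (measurable_itv _)))[N [mN N0 sN]].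
have : (leb `]0%R, t[ <= leb N)%E.
  apply: le_measure; rewrite ?inE//=.
  move=> x /= xt; apply: sN => /= H.
  have x01 : I01 x.
    by apply/I01E; move: xt; rewrite in_itv /= => /andP[-> /lt_trans ->].
  have := H x01; rewrite indicE mem_set//=; case=> /eqP; by rewrite oner_eq0.
rewrite N0 [leLHS]lebesgue_measure_itvE ?(ltW t0)// subr0 lee_fin.
by rewrite leNgt t0.
Qed.

Section Theory.
Variable rho : (R -> \bar R) -> \bar R.
Hypothesis rhoP : lattice_norm rho.

Lemma ln_le f g : mpos f -> mpos g ->
  (forall x, 0 < x < 1 -> (f x <= g x)%E) -> (rho f <= rho g)%E.
Proof. by move=> mf mg fg; apply: (ln_lattice rhoP) => //; exact: ae_I01W. Qed.

Lemma mpos0 : mpos (fun _ : R => 0%E).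
Proof. by split => //; exact: measurable_cst. Qed.

Lemma mpos1 : mpos (fun _ : R => 1%E).
Proof. by split => //; exact: measurable_cst. Qed.

Lemma ln0 : rho (fun _ => 0%E) = 0%E.
Proof.
have := ln_homog rhoP mpos0 (lexx 0).
rewrite (_ : (fun x => _) = (fun _ => 0%E)); first by rewrite mul0e.
by apply/funext => x; rewrite mul0e.
Qed.

Lemma ln_sum (n : nat) (h : nat -> R -> \bar R) : (forall k, mpos (h k)) ->
  (rho (fun x => \sum_(k < n) h k x) <= \sum_(k < n) rho (h k))%E.
Proof.
move=> mh; elim: n => [|n IH].
  rewrite big_ord0 (_ : (fun x => _) = (fun _ => 0%E)) ?ln0//.
  by apply/funext => x; rewrite big_ord0.
rewrite big_ord_recr /= (_ : (fun x => _) =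
  (fun x => \sum_(k < n) h k x + h n x)%E); last first.
  by apply/funext => x; rewrite big_ord_recr.
apply: le_trans (leeD2r _ IH); apply: (ln_triangle rhoP) => //; exact: mpos_sum.
Qed.

Lemma fundfun_fin (t : R) : fundfun rho t \is a fin_num.
Proof.
rewrite ge0_fin_numE; last by apply: (ln_ge0 rhoP); exact: mpos_indic.
apply: le_lt_trans (ln_one rhoP); apply: ln_le => //; first exact: mpos_indic.
by move=> x _; rewrite lee_fin indicE; case: (_ \in _).
Qed.

Lemma fundfun_le (s t : R) : s <= t -> (fundfun rho s <= fundfun rho t)%E.
Proof.
move=> st; apply: ln_le; try exact: mpos_indic.
move=> x _; rewrite lee_fin !indicE ler_nat.
case: (boolP (x \in `]0, s[%classic)) => // /set_mem /= xs.
rewrite mem_set //= in_itv /=; move: xs; rewrite in_itv /= => /andP[-> /=].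
by move/lt_le_trans; apply.
Qed.

(** With [u = sup F], the set [F] lies in (0,u) up to the point [u], so it suffices to bound the
    fundamental function at [u]. Since [u] need not belong to [F], the bound is first obtained at
    points below [u], each dominated by a point of [F], and passes to [u] by the Fatou property. *)
Lemma ln_indic_le (F : set R) (l : R) : measurable F -> F `<=` I01 -> 0 <= l ->
  (forall t, F t -> (fundfun rho t <= l%:E)%E) ->
  (rho (fun x => (\1_F x)%:E) <= l%:E)%E.
Proof.
move=> mF F01 l0 Fl.
have [->|/set0P[t0 Ft0]] := eqVneq F set0.
  rewrite (_ : (fun x => _) = (fun _ => 0%E)) ?ln0 ?lee_fin//.
  by apply/funext => x; rewrite indic0.
have F1 t : F t -> 0 < t < 1 by move=> /F01 /I01E.
have supF : has_sup F.
  by split; [exists t0|exists 1 => t /F1/andP[_ /ltW]].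
pose u := sup F.
have u0 : 0 < u.
  by have /andP[t00 _] := F1 _ Ft0; apply: lt_le_trans t00 (ub_le_sup supF.2 Ft0).
pose tn (n : nat) := u * (1 - n.+1%:R^-1).
have tn_u n : tn n < u.
  by rewrite /tn -[ltRHS]mulr1 ltr_pM2l// ltrBlDr ltrDl invr_gt0.
have tn_nd : {homo tn : n k / (n <= k)%N >-> n <= k}.
  move=> n k nk; rewrite /tn ler_pM2l// lerB// lef_pV2 ?posrE//.
  by rewrite ler_nat.
have tn_fund n : (fundfun rho (tn n) <= l%:E)%E.
  have e0 : 0 < u - tn n by rewrite subr_gt0.
  have [t Ft] := sup_adherent e0 supF; rewrite -/u subKr => /ltW tnt.
  by apply: le_trans (Fl _ Ft); exact: fundfun_le.
apply: (@le_trans _ _ (fundfun rho u)).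
  (* The comparison of indicators may fail at the single point [u], a null set. *)
  apply: (ln_lattice rhoP); try exact: mpos_indic.
  exists [set u]; split => //; first exact: lebesgue_measure_set1.
  move=> x /= /not_implyP[x01] /negP.
  rewrite -ltNge lte_fin !indicE ltr_nat.
  case: (boolP (x \in `]0, u[%classic)) => [_|/negP xu];
    case: (boolP (x \in F)) => // /set_mem Fx _.
  have := ub_le_sup supF.2 Fx; rewrite -/u le_eqVlt => /orP[/eqP//|xu'].
  exfalso; apply: xu; apply/mem_set; rewrite /= in_itv /= xu' andbT.
  by have /andP[] := F1 _ Fx.
suff cv : (fun n => fundfun rho (tn n)) @ \oo --> fundfun rho u.
  by apply: (cvge_to_le cv); exact: nearW.
apply: (ln_fatou rhoP); try by move=> *; exact: mpos_indic.
move=> x /andP[x0 x1]; split.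
  move=> k; rewrite lee_fin !indicE ler_nat.
  case: (boolP (x \in `]0, tn k[%classic)) => // /set_mem /= xs.
  rewrite mem_set //= in_itv /=; move: xs; rewrite in_itv /= => /andP[-> /=].
  by move/lt_le_trans; apply; exact: tn_nd.
have [xu|ux] := ltP x u; last first.
  rewrite indicE memNset /=; last by rewrite in_itv /= (ltNge x) ux andbF.
  rewrite (_ : (fun k => _) = (fun _ => 0%E)); first exact: cvg_cst.
  apply/funext => k; rewrite indicE memNset //= in_itv /=.
  by rewrite (ltNge x) (le_trans (ltW (tn_u k)) ux) andbF.
have /ltr_add_invr[k hk] : x / u < 1 by rewrite ltr_pdivrMr ?mul1r.
apply: cvg_near_cst; exists k => // n /= kn.
rewrite !indicE !mem_set //= in_itv /= x0 //=.
apply: (@lt_le_trans _ _ (tn k)); last exact: tn_nd.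
by rewrite /tn mulrC -ltr_pdivrMr// ltrBrDr.
Qed.

End Theory.
End LatticeNorm.

(** * Kernel operators, bounded along the level sets of the fundamental function *)

Section KernelOperators.
Context {R : realType}.
Local Notation leb := (@lebesgue_measure R).
Local Notation I01 := (@I01 R).
Implicit Types (Ker : R -> R -> \bar R) (g : R -> R) (t s a : R).

Definition kernel_op Ker g t : \bar R :=
  if (0 < t) && (t < 1) then (\int[leb]_(s in `]t, 1%R[) (`|g s|%:E * Ker t s))%E
  else 0%E.

(** These conditions make the image of a measurable function nonnegative and nonincreasing in [t],
    hence measurable. *)
Record admissible_kernel Ker : Prop := {
  ker_ge0 : forall t s, 0 < t -> t < s -> s < 1 -> (0 <= Ker t s)%E;
  ker_meas : forall t, 0 < t -> measurable_fun `]t, 1[ (Ker t);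
  ker_anti : forall t t' s, 0 < t -> t <= t' -> t' < s -> s < 1 ->
    (Ker t' s <= Ker t s)%E }.

Lemma sub_itv_I01 t : 0 < t -> `]t, 1[ `<=` I01.
Proof.
by move=> t0 s /=; rewrite in_itv /= => /andP[ts s1]; apply/I01E; rewrite s1 (lt_trans t0).
Qed.

Lemma measurable_absE g (D : set R) : measurable D -> D `<=` I01 ->
  measurable_fun I01 g -> measurable_fun D (fun s => `|g s|%:E).
Proof.
move=> mD D01 mg; apply: (measurable_funS measurable_I01 D01).
by case: (mpos_abs mg).
Qed.

Section Admissible.
Variable Ker : R -> R -> \bar R.
Hypothesis KerP : admissible_kernel Ker.

Lemma kernel_integrand_measurable g t : measurable_fun I01 g -> 0 < t ->
  measurable_fun `]t, 1[ (fun s => `|g s|%:E * Ker t s)%E.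
Proof.
move=> mg t0; apply: emeasurable_funM; last exact: ker_meas.
by apply: measurable_absE => //; exact: sub_itv_I01.
Qed.

Lemma kernel_integrand_ge0 g t s : 0 < t -> `]t, 1[%classic s ->
  (0 <= `|g s|%:E * Ker t s)%E.
Proof.
move=> t0; rewrite /= in_itv /= => /andP[ts s1].
by rewrite mule_ge0 ?lee_fin// (ker_ge0 KerP).
Qed.

Lemma mpos_kernel_op g : measurable_fun I01 g -> mpos (kernel_op Ker g).
Proof.
move=> mg; apply: mpos_nonincreasing.
  move=> t; rewrite /kernel_op; case: ifPn => // /andP[t0 t1].
  by apply: integral_ge0 => s; exact: kernel_integrand_ge0.
move=> t t' t0 tt' t'1; rewrite /kernel_op t'1 (lt_le_trans t0 tt') t0 (le_lt_trans tt' t'1) /=.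
have t'0 := lt_le_trans t0 tt'.
have sub : `]t', 1[%classic `<=` `]t, 1[%classic.
  by move=> s /=; rewrite !in_itv /= => /andP[/(le_lt_trans tt') -> ->].
apply: (@le_trans _ _ (\int[leb]_(s in `]t', 1%R[) (`|g s|%:E * Ker t s))%E).
  apply: ge0_le_integral => //.
  - by move=> s; exact: kernel_integrand_ge0.
  - exact: kernel_integrand_measurable.
  - apply: (measurable_funS _ sub) => //; exact: kernel_integrand_measurable.
  - move=> s /=; rewrite in_itv /= => /andP[ts s1].
    by rewrite lee_wpmul2l ?lee_fin// (ker_anti KerP).
apply: ge0_subset_integral => //; first exact: kernel_integrand_measurable.
by move=> s; exact: kernel_integrand_ge0.
Qed.

End Admissible.

Section Levels.
Variables (m : nat) (rho : (R -> \bar R) -> \bar R).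
Hypotheses (m0 : (0 < m)%N) (rhoP : lattice_norm rho).

Definition fundr t : R := fine (fundfun rho t).

(** On [level j] minus [level j.+1], called the j-th shell below, [2 ^+ j] is comparable to the m-th
    root of [fundr 1 / fundr s]; the factor [m] in the exponent keeps this root explicit. *)
Definition level (k : nat) : set R :=
  [set t | 0 < t < 1 /\ fundr t <= fundr 1 * (2^-1) ^+ (m * k)].

Lemma fundrE t : fundfun rho t = (fundr t)%:E.
Proof. by rewrite /fundr fineK// fundfun_fin. Qed.

Lemma fundr_gt0 t : 0 < t -> 0 < fundr t.
Proof.
move=> t0; rewrite -lte_fin -fundrE.
(* Positivity is postulated inside (0,1), hence the cut at 1/2. *)
apply: (@lt_le_trans _ _ (fundfun rho (Num.min t 2^-1))).
  apply: (ln_fund_gt0 rhoP); rewrite lt_min t0 invr_gt0 ltr0n /=.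
  by rewrite gt_min invf_lt1 ?ltr1n ?orbT.
by apply: fundfun_le => //; rewrite ge_min lexx.
Qed.

Lemma fundr_le s t : s <= t -> fundr s <= fundr t.
Proof. by move=> st; rewrite -lee_fin -!fundrE; exact: fundfun_le. Qed.

Lemma level0 t : 0 < t < 1 -> level 0 t.
Proof.
by move=> t01; split => //; rewrite muln0 expr0 mulr1 fundr_le// ltW//; case/andP: t01.
Qed.

Lemma levelS k t : level k.+1 t -> level k t.
Proof.
move=> [t01 h]; split => //; apply: le_trans h _.
rewrite ler_pM2l ?fundr_gt0// mulnS exprD ler_piMl ?exprn_ge0 ?invr_ge0//.
by rewrite exprn_ile1 ?invr_ge0// invf_le1 ?ler1n.
Qed.

Lemma level_le j k t : (j <= k)%N -> level k t -> level j t.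
Proof.
move=> jk; rewrite -(subnK jk); elim: (k - j)%N => [//|n IH].
by rewrite addSn => /levelS.
Qed.

Lemma level_down k s t : 0 < s -> s <= t -> level k t -> level k s.
Proof.
move=> s0 st [/andP[t0 t1] h]; split; first by rewrite s0 (le_lt_trans st).
exact: le_trans (fundr_le st) h.
Qed.

Lemma measurable_level k : measurable (level k).
Proof.
apply: is_interval_measurable => x y lx ly z /andP[xz zy].
by apply: level_down ly => //; case: lx => /andP[x0 _] _; exact: lt_le_trans xz.
Qed.

Lemma rho_level k :
  (rho (fun x => (\1_(level k) x)%:E) <= (fundr 1 * (2^-1) ^+ (m * k))%:E)%E.
Proof.
apply: ln_indic_le => //.
- exact: measurable_level.
- by move=> t [t01 _]; apply/I01E.
- by rewrite mulr_ge0 ?exprn_ge0 ?invr_ge0// ltW// fundr_gt0.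
- by move=> t [_ h]; rewrite fundrE lee_fin.
Qed.

Lemma not_level_ex t : 0 < t -> exists k, ~ level k t.
Proof.
move=> t0; have c0 : 0 < fundr t / fundr 1 by rewrite divr_gt0 ?fundr_gt0.
have : geometric (1 : R) 2^-1 @ \oo --> (0 : R).
  by apply: cvg_geometric; rewrite ger0_norm ?invr_ge0// invf_lt1 ?ltr1n.
move=> /cvgrPdist_lt /(_ _ c0)[n _ /(_ n (leqnn _))] /=.
rewrite sub0r normrN mul1r ger0_norm ?exprn_ge0 ?invr_ge0// => h.
exists n => -[_]; apply/negP; rewrite -ltNge mulrC -ltr_pdivlMr ?fundr_gt0//.
apply: le_lt_trans h; rewrite ler_wiXn2l ?invr_ge0 ?invf_le1 ?ler1n//.
by rewrite leq_pmull.
Qed.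

Lemma level_ex t : 0 < t < 1 -> exists k, level k t /\ ~ level k.+1 t.
Proof.
move=> t01; have /andP[t0 _] := t01.
have [k hk] := not_level_ex t0.
have ex : exists k, `[< ~ level k t >] by exists k; exact/asboolP.
case: (ex_minnP ex) => -[|n] /asboolP hn hmin; first by case: hn; exact: level0.
exists n; split => //; apply: contrapT => /asboolP /hmin; by rewrite ltnn.
Qed.

(** Exchanging the sums, each [2 ^+ j * c j] is multiplied by the geometric tail over [k >= j],
    which is [2 * 2^-1 ^+ j]. The second term on the left is the part of that tail with [k >= K];
    keeping it makes the identity exact and amenable to induction. *)
Lemma geometric_weighted_sum (c : nat -> R) (K : nat) :
  \sum_(k < K) 2^-1 ^+ k * (\sum_(j < k.+1) 2 ^+ j * c j)
    + 2 * 2^-1 ^+ K * (\sum_(j < K) 2 ^+ j * c j) = 2 * \sum_(j < K) c j :> R.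
Proof.
elim: K => [|K IH]; first by rewrite !big_ord0 !mulr0 addr0.
rewrite big_ord_recr /= [in RHS]big_ord_recr /= mulrDr -IH.
set S := \sum_(k < K) _.
rewrite big_ord_recr /=; set A := \sum_(j < K) _.
have e : 2^-1 ^+ K * 2 ^+ K = 1 :> R by rewrite -exprMn mulVf ?expr1n.
rewrite exprS; set x := 2^-1 ^+ K in e *.
transitivity (S + 2 * x * A + 2 * c K * (x * 2 ^+ K)); last by rewrite e mulr1.
by field; rewrite ?pnatr_eq0.
Qed.

Lemma sum_level_indic (K : nat) t :
  \sum_(j < K) \1_(level j `\` level j.+1) t <= 1 :> R.
Proof.
(* The first [K] shells are disjoint from [level K]; the induction carries the sum with this
   remainder included. *)
suff : \sum_(j < K) \1_(level j `\` level j.+1) t + \1_(level K) t <= 1 :> R.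
  by apply: le_trans; rewrite lerDl.
elim: K => [|K IH]; first by rewrite big_ord0 add0r indicE lern1; case: (_ \in _).
apply: le_trans IH; rewrite big_ord_recr /= -addrA lerD2l !indicE.
case: (pselect (level K t)) => lK.
  case: (pselect (level K.+1 t)) => lK1.
    rewrite [in X in X + _]memNset; last by move=> [_]; exact.
    by rewrite !mem_set// add0r.
  by rewrite (memNset lK1) addr0 !mem_set.
rewrite memNset; last by case.
by rewrite memNset ?add0r// => /levelS.
Qed.

Section UpperBound.
Variables (Ker : R -> R -> \bar R) (g : R -> R) (B : R).
Hypotheses (KerP : admissible_kernel Ker) (mg : measurable_fun I01 g) (B0 : 0 < B).
Hypothesis KerB : forall j k t s, 0 < t -> t < s -> s < 1 -> g s != 0 ->
  (j <= k)%N -> level j s -> ~ level j.+1 s -> ~ level k.+1 t ->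
  (Ker t s <= (B * 2 ^+ (m.-1 * k) * 2 ^+ j)%:E)%E.

Let ig := (\int[leb]_(s in I01) `|g s|%:E)%E.
Let c (j : nat) : R :=
  fine (\int[leb]_(s in I01) (\1_(level j `\` level j.+1) s * `|g s|)%:E)%E.
Let A (k : nat) : R := \sum_(j < k.+1) 2 ^+ j * c j.
(** The bound for [kernel_op Ker g] on the k-th shell. *)
Let b (k : nat) : R := B * 2 ^+ (m.-1 * k) * A k.

Let measurable_diff j : measurable (level j `\` level j.+1).
Proof. apply: measurableD; exact: measurable_level. Qed.

Let mpos_piece j : mpos (fun s => (\1_(level j `\` level j.+1) s * `|g s|)%:E).
Proof.
apply: mpos_EFin => [|s]; last by rewrite mulr_ge0.
by apply: measurable_funM; [exact: measurable_indic|exact: measurableT_comp].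
Qed.

Hypothesis ig_fin : (ig < +oo)%E.

Let cE j : (\int[leb]_(s in I01) (\1_(level j `\` level j.+1) s * `|g s|)%:E)%E
  = (c j)%:E.
Proof.
rewrite /c fineK// ge0_fin_numE; last first.
  by apply: integral_ge0 => s _; case: (mpos_piece j).
apply: le_lt_trans ig_fin; apply: ge0_le_integral => //.
- by case: (mpos_piece j).
- by case: (mpos_abs mg).
- by move=> s _; rewrite lee_fin ler_piMl// indicE; case: (_ \in _).
Qed.

Let c0 j : 0 <= c j.
Proof. by apply: fine_ge0; apply: integral_ge0 => s _; case: (mpos_piece j). Qed.

Let b0 k : 0 <= b k.
Proof.
have A0 : 0 <= A k by apply: sumr_ge0 => j _; rewrite mulr_ge0 ?exprn_ge0.
by rewrite /b !mulr_ge0 ?exprn_ge0// ltW.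
Qed.

Let sum_c K : ((\sum_(j < K) c j)%:E <= ig)%E.
Proof.
rewrite -sumEFin; under eq_bigr do rewrite -cE.
rewrite -ge0_integral_sum//; last by move=> j; case: (mpos_piece j).
apply: ge0_le_integral => //.
- by move=> s _; apply: sume_ge0 => j _; case: (mpos_piece j).
- by apply: emeasurable_sum => j; case: (mpos_piece j).
- by case: (mpos_abs mg).
- move=> s _; rewrite sumEFin lee_fin -mulr_suml ler_piMl//; exact: sum_level_indic.
Qed.

(** Levels are closed downwards, so every [s > t] lies in a shell of index [j <= k]. The integrand
    is dominated by a sum over these shells, on each of which [KerB] bounds the kernel by a
    constant. *)
Let pointwise k t : 0 < t < 1 -> level k t -> ~ level k.+1 t ->
  (kernel_op Ker g t <= (b k)%:E)%E.
Proof.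
move=> /andP[t0 t1] lt nlt; rewrite /kernel_op t0 t1 /=.
pose h s : \bar R := (\sum_(j < k.+1) ((B * 2 ^+ (m.-1 * k) * 2 ^+ j)%:E *
  (\1_(level j `\` level j.+1) s * `|g s|)%:E))%E.
have B2 j : 0 <= B * 2 ^+ (m.-1 * k) * 2 ^+ j.
  by rewrite !mulr_ge0 ?exprn_ge0// ltW.
have mh : mpos h.
  apply: (mpos_sum _ (h := fun j s => ((B * 2 ^+ (m.-1 * k) * 2 ^+ j)%:E *
    (\1_(level j `\` level j.+1) s * `|g s|)%:E)%E)) => j; exact: mposZ.
have sub := sub_itv_I01 t0.
apply: (@le_trans _ _ (\int[leb]_(s in `]t, 1%R[) h s)%E).
  apply: ge0_le_integral => //.
  - by move=> s; exact: kernel_integrand_ge0.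
  - exact: kernel_integrand_measurable.
  - by apply: (measurable_funS measurable_I01 sub); case: mh.
  - move=> s st1; move: (st1); rewrite /= in_itv /= => /andP[ts s1].
    have [gs0|gs0] := eqVneq (g s) 0.
      by rewrite gs0 normr0 mul0e; case: mh.
    have s0 := lt_trans t0 ts.
    have [j [lj nlj]] : exists k, level k s /\ ~ level k.+1 s.
      by apply: level_ex; rewrite s0.
    have jk : (j <= k)%N.
      rewrite leqNgt; apply/negP => kj; apply: nlt.
      by apply: (level_down t0 (ltW ts)); exact: level_le kj lj.
    have jk1 : (j < k.+1)%N by [].
    rewrite /h (bigD1 (Ordinal jk1)) //=.
    rewrite indicE mem_set//= mul1r.
    apply: lee_paddr.
      by apply: sume_ge0 => i _; rewrite mule_ge0 ?lee_fin ?B2// mulr_ge0.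
    by rewrite muleC lee_wpmul2r ?lee_fin//; exact: KerB.
apply: (@le_trans _ _ (\int[leb]_(s in I01) h s)%E).
  by apply: ge0_subset_integral => //; case: mh.
rewrite /h ge0_integral_sum//; first last.
- by move=> j s _; rewrite mule_ge0 ?lee_fin// mulr_ge0.
- by move=> j; apply: measurable_funeM; case: (mpos_piece j).
under eq_bigr => j _.
  rewrite ge0_integralZl_EFin//; last by case: (mpos_piece j).
  rewrite cE; over.
rewrite /b /A mulr_sumr -sumEFin le_eqVlt; apply/orP; left; apply/eqP.
by apply: eq_bigr => j _; rewrite -EFinM mulrA.
Qed.

(** Cutting off [level K] leaves finitely many shells, to which the triangle inequality applies;
    every [t > 0] eventually leaves [level K], so the Fatou property lets [K] grow. *)
Lemma kernel_op_upper_fin :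
  (rho (kernel_op Ker g) <= (2 * B * fundr 1)%:E * ig)%E.
Proof.
have mT := mpos_kernel_op KerP mg.
have mlev k := measurable_level k.
pose fk K x := (kernel_op Ker g x * (\1_(~` level K) x)%:E)%E.
have mfk K : mpos (fk K).
  by apply: mpos_mulindic => //; exact: measurableC.
have cv : (fun K => rho (fk K)) @ \oo --> rho (kernel_op Ker g).
  apply: (ln_fatou rhoP) => // x /andP[x0 x1]; split.
    move=> K; rewrite /fk lee_wpmul2l ?lee_fin//; first by case: mT.
    rewrite !indicE ler_nat; case: (pselect (level K x)) => lK.
      by rewrite memNset.
    by rewrite mem_set// mem_set// => /levelS.
  have [n hn] := not_level_ex x0.
  apply: cvg_near_cst; exists n => // K /= nK.
  rewrite /fk indicE mem_set ?mule1// => lK; apply: hn; exact: level_le nK lK.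
apply: (cvge_to_le cv); apply: nearW => K.
(* Shells are enlarged to full levels, whose indicators are controlled by [rho_level]. *)
apply: (@le_trans _ _ (rho (fun x => \sum_(k < K) ((b k)%:E * (\1_(level k) x)%:E))%E)).
  apply: ln_le => //.
    apply: (mpos_sum _ (h := fun k x => ((b k)%:E * (\1_(level k) x)%:E)%E)) => k.
    by apply: mposZ => //; exact: mpos_indic.
  move=> x x01; rewrite /fk.
  have sge0 (P : pred 'I_K) : (0 <= \sum_(k < K | P k) ((b k)%:E * (\1_(level k) x)%:E))%E.
    by apply: sume_ge0 => k _; rewrite mule_ge0 ?lee_fin.
  case: (pselect (level K x)) => lK.
    by rewrite indicE memNset ?mule0.
  rewrite indicE mem_set// mule1.
  have [k [lk nlk]] := level_ex x01.
  have kK : (k < K)%N.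
    by rewrite ltnNge; apply/negP => Kk; apply: lK; exact: level_le Kk lk.
  rewrite (bigD1 (Ordinal kK)) //= indicE mem_set// mule1.
  by apply: lee_paddr => //; exact: pointwise.
apply: (le_trans (ln_sum rhoP K (h := fun k x => ((b k)%:E * (\1_(level k) x)%:E)%E) _)).
  by move=> k; apply: mposZ => //; exact: mpos_indic.
apply: (@le_trans _ _ (\sum_(k < K) (b k * (fundr 1 * 2^-1 ^+ (m * k)))%:E)%E).
  apply: lee_sum => k _; rewrite (ln_homog rhoP) ?b0//; last exact: mpos_indic.
  by rewrite (EFinM (b k)); apply: lee_wpmul2l; [rewrite lee_fin|exact: rho_level].
rewrite sumEFin.
apply: (@le_trans _ _ (2 * B * fundr 1 * \sum_(j < K) c j)%:E); last first.
  rewrite EFinM lee_wpmul2l ?lee_fin// ?sum_c// !mulr_ge0//; last exact/ltW/fundr_gt0.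
  exact: ltW.
rewrite lee_fin.
(* The growth [2 ^+ (m.-1 * k)] of the kernel against the decay [2^-1 ^+ (m * k)] of the level
   leaves the weight [2^-1 ^+ k]. *)
rewrite (_ : \sum_(k < K) _ = B * fundr 1 * \sum_(k < K) 2^-1 ^+ k * A k); last first.
  rewrite mulr_sumr; apply: eq_bigr => k _; rewrite /b.
  have -> : (m * k = m.-1 * k + k)%N by rewrite -[in LHS](prednK m0) mulSn addnC.
  have e : 2 ^+ (m.-1 * k) * 2^-1 ^+ (m.-1 * k) = 1 :> R.
    by rewrite -exprMn divff ?expr1n.
  rewrite exprD.
  transitivity (B * fundr 1 * (2^-1 ^+ k * A k) * (2 ^+ (m.-1 * k) * 2^-1 ^+ (m.-1 * k))).
    by ring.
  by rewrite e mulr1.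
rewrite (_ : 2 * B * _ * _ = B * fundr 1 * (2 * \sum_(j < K) c j)); last by ring.
rewrite ler_pM2l ?mulr_gt0 ?fundr_gt0// -geometric_weighted_sum lerDl.
by rewrite !mulr_ge0 ?exprn_ge0 ?invr_ge0// sumr_ge0// => j _; rewrite mulr_ge0 ?exprn_ge0.
Qed.

End UpperBound.

(** The kernel bound is requested only where [g] does not vanish, so for [g = restr a f] a bound
    valid for [s < a] is enough. An infinite integral makes the right-hand side [+oo], its
    coefficient being positive. *)
Lemma kernel_op_upper Ker g (B : R) :
  admissible_kernel Ker -> measurable_fun I01 g -> 0 < B ->
  (forall j k t s, 0 < t -> t < s -> s < 1 -> g s != 0 ->
    (j <= k)%N -> level j s -> ~ level j.+1 s -> ~ level k.+1 t ->
    (Ker t s <= (B * 2 ^+ (m.-1 * k) * 2 ^+ j)%:E)%E) ->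
  (rho (kernel_op Ker g) <=
    (2 * B * fundr 1)%:E * \int[leb]_(s in I01) `|g s|%:E)%E.
Proof.
move=> KerP mg B0 KerB.
have [fin|] := ltP (\int[leb]_(s in I01) `|g s|%:E)%E +oo%E.
  exact: kernel_op_upper_fin.
rewrite leye_eq => /eqP ->; rewrite gt0_muley ?leey// lte_fin.
by rewrite !mulr_gt0// fundr_gt0.
Qed.

End Levels.
End KernelOperators.

(** * The kernels of K and H *)

Section HardyKernels.
Context {R : realType}.
Local Notation leb := (@lebesgue_measure R).
Local Notation I01 := (@I01 R).
Variables (m : nat) (I : R -> R).
Hypotheses (m0 : (0 < m)%N) (I_gt0 : forall t, 0 < t <= 1 -> 0 < I t).
Hypothesis I_nd : forall s t, 0 < s -> s <= t -> t <= 1 -> I s <= I t.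
Implicit Types (g : R -> R) (a d r s t : R).

Definition kernelK (t s : R) : \bar R := (s ^+ m.-1 / I s ^+ m)%:E.

Definition inner (t s : R) : \bar R := (\int[leb]_(r in `]t, s[) ((I r)^-1)%:E)%E.

Definition kernelH (t s : R) : \bar R :=
  (((m.-1)`!%:R^-1 / I s)%:E * inner t s ^+ m.-1)%E.

Let I0 s : 0 < s -> s < 1 -> 0 < I s.
Proof. by move=> s0 s1; apply: I_gt0; rewrite s0 ltW. Qed.

Let lef_invI s t : 0 < s -> s <= t -> t < 1 -> (I t)^-1 <= (I s)^-1.
Proof.
move=> s0 st t1; rewrite lef_pV2 ?posrE ?I0 ?(lt_le_trans s0 st) ?(le_lt_trans st t1)//.
by apply: I_nd => //; exact: ltW.
Qed.

Let measurable_invI : measurable_fun I01 (fun r => ((I r)^-1)%:E).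
Proof.
apply: measurable_fun_nonincreasing; first exact: interval_is_interval.
by move=> x y /I01E/andP[x0 _] /I01E/andP[_ y1] xy; rewrite lee_fin lef_invI.
Qed.

Lemma sub_itv2_I01 (b1 b2 : bool) t s : 0 < t -> s < 1 ->
  [set` Interval (BSide b1 t) (BSide b2 s)] `<=` I01.
Proof.
move=> t0 s1 r /=; rewrite itv_boundlr => /andP[/= tr rs]; apply/I01E.
have tr' : t <= r by move: tr; case: b1 => //= /ltW.
have rs' : r <= s by move: rs; case: b2 => //= /ltW.
by rewrite (lt_le_trans t0)//= (le_lt_trans rs').
Qed.

Let measurable_invI_itv (b1 b2 : bool) t s : 0 < t -> s < 1 ->
  measurable_fun [set` Interval (BSide b1 t) (BSide b2 s)] (fun r => ((I r)^-1)%:E).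
Proof.
by move=> t0 s1; apply: (measurable_funS measurable_I01 (sub_itv2_I01 t0 s1)).
Qed.

Let invI_ge0 (b1 b2 : bool) t s r : 0 < t -> s < 1 ->
  [set` Interval (BSide b1 t) (BSide b2 s)] r -> (0 <= ((I r)^-1)%:E)%E.
Proof.
move=> t0 s1 /(sub_itv2_I01 t0 s1)/I01E/andP[r0 r1].
by rewrite lee_fin invr_ge0 ltW// I0.
Qed.

Lemma inner_ge0 t s : 0 < t -> s < 1 -> (0 <= inner t s)%E.
Proof. by move=> t0 s1; apply: integral_ge0 => r; exact: invI_ge0. Qed.

Lemma inner_le t t' s s' : 0 < t -> t <= t' -> s' <= s -> s < 1 ->
  (inner t' s' <= inner t s)%E.
Proof.
move=> t0 tt' ss' s1; apply: ge0_subset_integral => //.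
- exact: measurable_invI_itv.
- by move=> r; exact: invI_ge0.
- move=> r /=; rewrite !in_itv /= => /andP[tr rs].
  by rewrite (le_lt_trans tt' tr) (lt_le_trans rs).
Qed.

(** On the interval of integration [1 / I] is at least its value at the right end. *)
Lemma inner_lower t s : 0 < t -> t <= s -> s < 1 ->
  (((s - t) / I s)%:E <= inner t s)%E.
Proof.
move=> t0 ts s1.
apply: (@le_trans _ _ (\int[leb]_(r in `]t, s[) ((I s)^-1)%:E)%E).
  by rewrite integral_cst// [X in (_ * X)%E]lebesgue_measure_itvE// -EFinM mulrC.
apply: ge0_le_integral => //.
- by move=> r _; rewrite lee_fin invr_ge0 ltW// I0// (lt_le_trans t0).
- exact: measurable_invI_itv.
- move=> r /=; rewrite in_itv /= => /andP[tr rs].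
  by rewrite lee_fin lef_invI// ?(lt_trans t0)// ltW.
Qed.

Lemma le_expe2r (n : nat) (x y : \bar R) :
  (0 <= x -> x <= y -> x ^+ n <= y ^+ n)%E.
Proof.
move=> x0 xy; elim: n => [|n IH]; first by rewrite !expe0.
rewrite !expeS; apply: lee_pmul => //; exact: expe_ge0.
Qed.

Let factV_ge0 : 0 <= ((m.-1)`!%:R^-1 : R).
Proof. by rewrite invr_ge0. Qed.

Lemma kernelK_admissible : admissible_kernel kernelK.
Proof.
split.
- move=> t s t0 ts s1; rewrite lee_fin divr_ge0 ?exprn_ge0//.
    by rewrite (ltW (lt_trans t0 ts)).
  by rewrite ltW// I0// (lt_trans t0).
- move=> t t0; apply: (measurable_funS measurable_I01 (sub_itv_I01 t0)).
  rewrite (_ : kernelK t = (fun s => (s ^+ m.-1)%:E * ((I s ^+ m)^-1)%:E)%E); last first.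
    by apply/funext => s; rewrite -EFinM.
  apply: emeasurable_funM.
    by apply/measurable_EFinP; exact: measurable_funX.
  apply: measurable_fun_nonincreasing; first exact: interval_is_interval.
  move=> x y /I01E/andP[x0 x1] /I01E/andP[y0 y1] xy; rewrite lee_fin -!exprVn.
  by rewrite lerXn2r ?nnegrE ?invr_ge0 ?lef_invI// ltW// I0.
- by [].
Qed.

(** In [s] the kernel is the product of a nonincreasing and a nondecreasing function, hence
    measurable; in [t] it decreases because the inner interval shrinks. *)
Lemma kernelH_admissible : admissible_kernel kernelH.
Proof.
have cI s : 0 < s -> s < 1 -> (0 <= ((m.-1)`!%:R^-1 / I s)%:E)%E.
  by move=> s0 s1; rewrite lee_fin mulr_ge0// invr_ge0 ltW// I0.
split.
- move=> t s t0 ts s1; rewrite /kernelH mule_ge0 ?cI ?expe_ge0 ?inner_ge0//.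
  exact: lt_trans ts.
- move=> t t0; apply: emeasurable_funM.
    apply: measurable_fun_nonincreasing; first exact: interval_is_interval.
    move=> x y /(sub_itv_I01 t0)/I01E/andP[x0 _] /(sub_itv_I01 t0)/I01E/andP[_ y1] xy.
    by rewrite lee_fin ler_wpM2l ?lef_invI.
  apply: measurable_fun_nondecreasing; first exact: interval_is_interval.
  move=> x y /(sub_itv_I01 t0)/I01E/andP[x0 x1] /(sub_itv_I01 t0)/I01E/andP[_ y1] xy.
  by apply: le_expe2r; [exact: inner_ge0|exact: inner_le].
- move=> t t' s t0 tt' t's s1; have t'0 := lt_le_trans t0 tt'.
  apply: lee_wpmul2l; first by rewrite cI// (lt_trans t'0).
  by apply: le_expe2r; [exact: inner_ge0|exact: inner_le].
Qed.

Lemma KopE g : Kop m I g = kernel_op kernelK g.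
Proof.
apply/funext => t; rewrite /Kop /kernel_op; case: ifP => // _.
by apply: eq_integral => s _; rewrite /kernelK -EFinM mulrA.
Qed.

(** The factorial stands outside the integral in [Hop] and inside it in [kernelH]; measurability of
    [g] lets it cross. *)
Lemma HopE g : measurable_fun I01 g -> Hop m I g = kernel_op kernelH g.
Proof.
move=> mg; apply/funext => t; rewrite /Hop /kernel_op; case: ifP => // /andP[t0 t1].
have E s : (`|g s|%:E * kernelH t s =
    ((m.-1)`!%:R^-1)%:E * ((`|g s| / I s)%:E * inner t s ^+ m.-1))%E.
  rewrite /kernelH muleA -EFinM muleA -EFinM; congr (_%:E * _)%E.
  by rewrite mulrCA.
under [RHS]eq_integral do rewrite E.
rewrite ge0_integralZl_EFin//.
- move=> s; rewrite /= in_itv /= => /andP[ts s1].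
  rewrite mule_ge0 ?expe_ge0 ?inner_ge0// lee_fin divr_ge0// ltW// I0//.
  exact: lt_trans ts.
- apply: (@emeasurable_funM _ _ _ _ (fun s => (`|g s| / I s)%:E) (fun s => inner t s ^+ m.-1)%E).
    have -> : (fun s => (`|g s| / I s)%:E) = (fun s => `|g s|%:E * ((I s)^-1)%:E)%E.
      by apply/funext => s; rewrite -EFinM.
    apply: emeasurable_funM.
      by apply: measurable_absE => //; exact: sub_itv_I01.
    by apply: (measurable_funS measurable_I01 (sub_itv_I01 t0)).
  apply: measurable_fun_nondecreasing; first exact: interval_is_interval.
  move=> x y /(sub_itv_I01 t0)/I01E/andP[x0 x1] /(sub_itv_I01 t0)/I01E/andP[_ y1] xy.
  by apply: le_expe2r; [exact: inner_ge0|exact: inner_le].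
Qed.

End HardyKernels.

(** * Upper and lower bounds for the two kernels *)

Section KernelBounds.
Context {R : realType}.
Local Notation leb := (@lebesgue_measure R).
Local Notation I01 := (@I01 R).
Variables (m : nat) (I : R -> R).
Hypotheses (m0 : (0 < m)%N) (I_gt0 : forall t, 0 < t <= 1 -> 0 < I t).
Hypothesis I_nd : forall s t, 0 < s -> s <= t -> t <= 1 -> I s <= I t.
Implicit Types (a d r s t : R).

(** The constant is uniform in the norm, so the bound serves with [rho] in (a) and with [L1norm] in
    (b). The small parameter enters as [d ^+ m] to avoid roots, and [2 ^+ (m.-1 * k) * 2 ^+ j] is
    the dyadic form, up to normalisation, of [phi(t)^(-(m-1)/m) phi(s)^(-1/m)]. *)
Definition kernel_upper (Ker : R -> R -> \bar R) (C : R) : Prop :=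
  forall (rho : (R -> \bar R) -> \bar R) (d a : R), lattice_norm rho -> 0 < d ->
  (forall s, 0 < s -> s < a -> s < 1 ->
     s ^+ m.-1 * fundr rho s <= d ^+ m * fundr rho 1 * I s ^+ m) ->
  forall j k t s, 0 < t -> t < s -> s < 1 -> s < a -> (j <= k)%N ->
    level m rho j s -> ~ level m rho j.+1 s -> ~ level m rho k.+1 t ->
    (Ker t s <= (C * d ^+ m * 2 ^+ (m.-1 * k) * 2 ^+ j)%:E)%E.

(** The gap between [a / 4] and [a / 2] keeps [s - t] above [a / 4], which makes the inner integral
    of H large. *)
Definition kernel_lower (Ker : R -> R -> \bar R) (c : R) : Prop :=
  forall a t s, a < 1 -> 0 < t -> t < a / 4 -> a / 2 < s -> s < a ->
    ((c * (a ^+ m.-1 / I a ^+ m))%:E <= Ker t s)%E.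

Let I0 s : 0 < s -> s < 1 -> 0 < I s.
Proof. by move=> s0 s1; apply: I_gt0; rewrite s0 ltW. Qed.

Let mE : m = m.-1.+1. Proof. by rewrite prednK. Qed.

Lemma not_levelP (rho : (R -> \bar R) -> \bar R) k s : 0 < s -> s < 1 ->
  ~ level m rho k s -> fundr rho 1 * 2^-1 ^+ (m * k) < fundr rho s.
Proof.
move=> s0 s1 h; rewrite ltNge; apply/negP => h'; apply: h; split => //.
by rewrite s0.
Qed.

Let pow2V n : 2^-1 ^+ n * 2 ^+ n = 1 :> R.
Proof. by rewrite -exprMn mulVf ?expr1n. Qed.

(** Outside [level j.+1] the fundamental function at [s] is at least [2^-1 ^+ (m * j.+1)] times its
    value at 1, so the kernel is at most [d ^+ m * 2 ^+ (m * j.+1)]. The exponent splits as m +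
    (m-1)j + j, and [j <= k]. *)
Lemma kernelK_upper : kernel_upper (kernelK m I) (2 ^+ m).
Proof.
move=> rho d a rhoP d0 hI j k t s t0 ts s1 sa jk lj nlj nlk.
have s0 := lt_trans t0 ts.
have Is0 : 0 < I s ^+ m by rewrite exprn_gt0 ?I0.
have P0 := fundr_gt0 rhoP (ltr01 : 0 < 1 :> R).
rewrite /kernelK lee_fin ler_pdivrMr//.
have h1 := hI _ s0 sa s1; have /ltW h2 := not_levelP s0 s1 nlj.
have h3 : s ^+ m.-1 * 2^-1 ^+ (m * j.+1) <= d ^+ m * I s ^+ m.
  rewrite -(ler_pM2l P0); apply: le_trans (_ : _ <= s ^+ m.-1 * fundr rho s) _.
    by rewrite mulrCA ler_pM2l// exprn_gt0.
  by apply: le_trans h1 _; rewrite mulrAC mulrC.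
have h4 : s ^+ m.-1 <= d ^+ m * I s ^+ m * 2 ^+ (m * j.+1).
  have -> : s ^+ m.-1 = s ^+ m.-1 * 2^-1 ^+ (m * j.+1) * 2 ^+ (m * j.+1).
    by rewrite -mulrA pow2V mulr1.
  by rewrite ler_pM2r ?exprn_gt0.
apply: le_trans h4 _.
have e : (m * j.+1 = m + m.-1 * j + j)%N.
  by rewrite mulnS -addnA; congr addn; rewrite {1}mE mulSn addnC.
rewrite e !exprD.
have h5 : 2 ^+ (m.-1 * j) <= 2 ^+ (m.-1 * k) :> R.
  by rewrite ler_eXn2l ?ltr1n// leq_mul2l jk orbT.
have -> : d ^+ m * I s ^+ m * (2 ^+ m * 2 ^+ (m.-1 * j) * 2 ^+ j) =
  (d ^+ m * I s ^+ m * 2 ^+ m * 2 ^+ j) * 2 ^+ (m.-1 * j) by ring.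
have -> : 2 ^+ m * d ^+ m * 2 ^+ (m.-1 * k) * 2 ^+ j * I s ^+ m =
  (d ^+ m * I s ^+ m * 2 ^+ m * 2 ^+ j) * 2 ^+ (m.-1 * k) by ring.
by rewrite ler_wpM2l// !mulr_ge0 ?exprn_ge0// ltW// I0.
Qed.

Lemma kernelK_lower : kernel_lower (kernelK m I) (2^-1 ^+ m.-1).
Proof.
move=> a t s a1 t0 ta as_ sa.
have a0 : 0 < a by lra.
have s0 : 0 < s by lra.
have s1 : s < 1 by lra.
rewrite /kernelK lee_fin mulrA -exprMn.
have Is0 : 0 < I s by rewrite I0// (lt_trans sa).
apply: ler_pM.
- by rewrite exprn_ge0// mulr_ge0 ?invr_ge0 ?ltW.
- by rewrite invr_ge0 exprn_ge0// ltW// I0.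
- by rewrite lerXn2r ?nnegrE ?mulr_ge0 ?invr_ge0 ?ltW// mulrC.
- rewrite lef_pV2 ?posrE ?exprn_gt0 ?I0//.
  apply: lerXn2r; rewrite ?nnegrE; [exact: ltW|by rewrite ltW// I0|].
  by apply: I_nd => //; exact: ltW.
Qed.

Lemma kernelH_lower :
  kernel_lower (kernelH m I) ((m.-1)`!%:R^-1 * 4^-1 ^+ m.-1).
Proof.
move=> a t s a1 t0 ta as_ sa.
have a0 : 0 < a by lra.
have s0 : 0 < s by lra.
have s1 : s < 1 by lra.
have Is0 : 0 < I s by rewrite I0.
have Isa : I s <= I a by apply: I_nd; lra.
have c0 : 0 <= ((m.-1)`!%:R^-1 : R) by rewrite invr_ge0.
have iI : (I a)^-1 <= (I s)^-1 by rewrite lef_pV2 ?posrE ?I0.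
have iI0 : 0 <= (I a)^-1 by rewrite invr_ge0 ltW// I0.
apply: (@le_trans _ _ (((m.-1)`!%:R^-1 / I s)%:E * ((s - t) / I s)%:E ^+ m.-1)%E).
  rewrite -EFin_expe -EFinM lee_fin.
  have -> : (m.-1)`!%:R^-1 * 4^-1 ^+ m.-1 * (a ^+ m.-1 / I a ^+ m) =
    (m.-1)`!%:R^-1 / I a * ((a / 4) / I a) ^+ m.-1.
    have -> : I a ^+ m = I a * I a ^+ m.-1 by rewrite -exprS prednK.
    by rewrite invfM !exprMn !exprVn; ring.
  apply: ler_pM.
  - by rewrite mulr_ge0.
  - by rewrite exprn_ge0// !mulr_ge0// ltW.
  - by rewrite ler_wpM2l.
  - have st : a / 4 <= s - t by lra.
    have a40 : 0 <= a / 4 by lra.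
    apply: lerXn2r; rewrite ?nnegrE; last exact: ler_pM.
      exact: mulr_ge0.
    by rewrite mulr_ge0 ?invr_ge0 ?(ltW Is0)// (le_trans a40).
apply: lee_wpmul2l; first by rewrite lee_fin mulr_ge0// invr_ge0 ltW.
apply: le_expe2r; first by rewrite lee_fin divr_ge0 ?(ltW Is0)//; lra.
by apply: inner_lower => //; lra.
Qed.

Section HUpper.
Variables (rho : (R -> \bar R) -> \bar R) (d a : R).
Hypotheses (rhoP : lattice_norm rho) (d0 : 0 < d).
Hypothesis hI : forall s, 0 < s -> s < a -> s < 1 ->
  s ^+ m.-1 * fundr rho s <= d ^+ m * fundr rho 1 * I s ^+ m.

(** A dyadic scale for the variable itself; the factor [m] makes [q n ^+ m.-1] an exact m-th
    power. *)
Let q (n : nat) : R := 2^-1 ^+ (m * n).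

Let q_gt0 n : 0 < q n. Proof. by rewrite exprn_gt0 ?invr_gt0. Qed.

(** This stands for the extraction of m-th roots: [d ^+ m * I r ^+ m] is at least
    [q n.+1 ^+ m.-1 * q k.+1], and both factors are m-th powers of powers of 1/2. *)
Lemma invI_bound k n r : 0 < r -> r < a -> r < 1 -> ~ level m rho k.+1 r ->
  q n.+1 <= r -> (I r)^-1 <= d * 2 ^+ k.+1 * 2 ^+ (m.-1 * n.+1).
Proof.
move=> r0 ra r1 nlk qr.
have Ir0 := I0 r0 r1.
have P0 := fundr_gt0 rhoP (ltr01 : 0 < 1 :> R).
set D := _ * _.
have D0 : 0 < D by rewrite !mulr_gt0 ?exprn_gt0.
rewrite -[leLHS]mul1r ler_pdivrMr//.
suff : 1 ^+ m <= (D * I r) ^+ m.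
  have DI0 := ltW (mulr_gt0 D0 Ir0); by rewrite ler_pXn2r ?nnegrE.
rewrite expr1n.
have h1 := hI r0 ra r1; have /ltW h2 := not_levelP r0 r1 nlk.
have h3 : q n.+1 ^+ m.-1 * q k.+1 <= d ^+ m * I r ^+ m.
  rewrite -(ler_pM2l P0); apply: (@le_trans _ _ (r ^+ m.-1 * fundr rho r)).
    rewrite mulrCA; apply: ler_pM => //.
    - by rewrite exprn_ge0// ltW.
    - by rewrite mulr_ge0// ltW.
    - by apply: lerXn2r; rewrite ?nnegrE// ltW.
  by apply: le_trans h1 _; rewrite mulrAC mulrC.
have -> : (D * I r) ^+ m = d ^+ m * I r ^+ m * 2 ^+ (m * k.+1) * 2 ^+ (m * n.+1 * m.-1).
  rewrite /D !exprMn -!exprM [(k.+1 * m)%N]mulnC.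
  have -> : (m.-1 * n.+1 * m = m * n.+1 * m.-1)%N by rewrite mulnC [(m.-1 * _)%N]mulnC mulnA.
  by ring.
apply: (@le_trans _ _ (q n.+1 ^+ m.-1 * q k.+1 * 2 ^+ (m * k.+1) * 2 ^+ (m * n.+1 * m.-1))).
  rewrite /q -exprM -[_ * _ * 2 ^+ (m * k.+1)]mulrA pow2V mulr1 pow2V //.
by rewrite !ler_pM2r ?exprn_gt0.
Qed.

(** Between [q n.+1] and [q n] the integrand is at most [B * 2 ^+ (m.-1 * n)] and the length at most
    [2^-1 ^+ (m * n)], so this block contributes at most [B * 2^-1 ^+ n]; the blocks down to [t]
    then sum to at most twice that. The induction is on [e], which bounds the number of blocks.
    Levels being closed downwards, no point to the right of [t] is in [level k.+1]. *)
Lemma inner_upper k (e : nat) : forall n t s, 0 < t -> t <= s -> s <= a -> s < 1 ->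
  ~ level m rho k.+1 t -> q (n + e) <= t -> s <= q n ->
  (inner I t s <= (2 * (d * 2 ^+ k.+1 * 2 ^+ m.-1) * 2^-1 ^+ n)%:E)%E.
Proof.
set B := d * _ * _; have B0 : 0 < B by rewrite !mulr_gt0 ?exprn_gt0.
(* The flag [b1] covers both the open end at [t] and the closed end at a splitting point. *)
have block n u s (b1 : bool) : 0 < u -> u <= s -> s <= a -> s < 1 ->
  ~ level m rho k.+1 u -> q n.+1 <= u -> s <= q n ->
  (\int[leb]_(r in [set` Interval (BSide b1 u) (BLeft s)]) ((I r)^-1)%:E
    <= (B * 2^-1 ^+ n)%:E)%E.
  move=> u0 us sa s1 nlu qu sq.
  apply: (@le_trans _ _ ((B * 2 ^+ (m.-1 * n)) * (s - u))%:E).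
    apply: (le_trans (_ : _ <= \int[leb]_(r in [set` Interval (BSide b1 u) (BLeft s)])
        (B * 2 ^+ (m.-1 * n))%:E)%E).
      apply: ge0_le_integral => //.
      - move=> r /(sub_itv2_I01 u0 s1)/I01E/andP[r0 r1].
        by rewrite lee_fin invr_ge0 ltW// I0.
      - apply: (measurable_funS measurable_I01 (sub_itv2_I01 u0 s1)).
        apply: measurable_fun_nonincreasing; first exact: interval_is_interval.
        move=> x y /I01E/andP[x0 x1] /I01E/andP[y0 y1] xy; rewrite lee_fin.
        by rewrite lef_pV2 ?posrE ?I0// I_nd// ltW.
      - move=> r ri; have /I01E/andP[r0 r1] := sub_itv2_I01 u0 s1 ri.
        move: ri; rewrite /= itv_boundlr => /andP[/= ur rs].
        have ur' : u <= r by move: ur; case: (b1) => //= /ltW.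
        have -> : B * 2 ^+ (m.-1 * n) = d * 2 ^+ k.+1 * 2 ^+ (m.-1 * n.+1).
          by rewrite mulnS exprD mulrA.
        rewrite lee_fin invI_bound//.
        + exact: lt_le_trans sa.
        + by move=> lr; apply: nlu; exact: level_down lr.
        + exact: le_trans qu ur'.
    by rewrite integral_cst// [X in (_ * X)%E]lebesgue_measure_itvE// -EFinM.
  rewrite lee_fin -mulrA ler_pM2l//.
  apply: (@le_trans _ _ (2 ^+ (m.-1 * n) * q n)).
    by rewrite ler_pM2l ?exprn_gt0//; lra.
  have -> : q n = 2^-1 ^+ n * 2^-1 ^+ (m.-1 * n) by rewrite /q -exprD -mulSn prednK.
  by rewrite mulrCA [2 ^+ _ * _]mulrC pow2V mulr1.
elim: e => [|e IH] n t s t0 ts sa s1 nlt qt sq.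
  (* Here [s <= q n <= t], so the interval is empty. *)
  rewrite addn0 in qt.
  rewrite /inner set_itv_ge; last by rewrite bnd_simp -leNgt (le_trans sq).
  by rewrite integral_set0 lee_fin !mulr_ge0 ?exprn_ge0 ?invr_ge0// ltW.
have h : B * 2^-1 ^+ n <= 2 * B * 2^-1 ^+ n.
  by rewrite -[leLHS]mul1r -mulrA ler_pM2r ?ler1n// mulr_gt0 ?exprn_gt0 ?invr_gt0.
have [qt1|tq1] := leP (q n.+1) t.
  by apply: (@le_trans _ _ (B * 2^-1 ^+ n)%:E); [exact: (block n t s false)|rewrite lee_fin].
have qt' : q (n.+1 + e) <= t by rewrite addSnnS.
have half : 2 * B * 2^-1 ^+ n.+1 = B * 2^-1 ^+ n.
  by rewrite exprS; field; rewrite ?pnatr_eq0.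
have [sq1|q1s] := leP s (q n.+1).
  apply: (@le_trans _ _ (2 * B * 2^-1 ^+ n.+1)%:E); first exact: IH.
  by rewrite lee_fin half.
rewrite /inner (@itv_bndbnd_setU _ _ (BRight t) (BLeft (q n.+1)) (BLeft s)) ?bnd_simp//;
  last exact: ltW.
rewrite ge0_integral_setU//; first last.
- by apply/disj_setPS => r /= []; rewrite !in_itv /= => /andP[_ rq] /andP[]; rewrite leNgt rq.
- move=> r; rewrite -itv_bndbnd_setU ?bnd_simp//; last exact: ltW.
  by move=> /(sub_itv2_I01 t0 s1)/I01E/andP[r0 r1]; rewrite lee_fin invr_ge0 ltW// I0.
- rewrite -itv_bndbnd_setU ?bnd_simp//; last exact: ltW.
  apply: (measurable_funS measurable_I01 (sub_itv2_I01 t0 s1)).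
  apply: measurable_fun_nonincreasing; first exact: interval_is_interval.
  move=> x y /I01E/andP[x0 x1] /I01E/andP[y0 y1] xy; rewrite lee_fin.
  by rewrite lef_pV2 ?posrE ?I0// I_nd// ltW.
(* The bound at [n.+1] is half the bound at [n]; one more block makes up the other half. *)
have -> : 2 * B * 2^-1 ^+ n = 2 * B * 2^-1 ^+ n.+1 + B * 2^-1 ^+ n.
  by rewrite half; ring.
rewrite EFinD; apply: leeD.
  apply: IH => //; [exact: ltW|exact: le_trans (ltW q1s) sa|exact: lt_trans q1s s1].
apply: block => //; first exact: ltW.
by move=> lr; apply: nlt; exact: level_down (ltW tq1) lr.
Qed.

End HUpper.

(** [invI_bound] handles [1 / I s] and [inner_upper] the power of the inner integral; the powers of
    2 depending on [n] cancel. In the constant, 2 comes from [j.+1]; [2 ^+ (3 * m.-1)] from [n.+1],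
    [k.+1] and the leading 2 of [inner_upper]; the last factor from its [2 ^+ m.-1]. *)
Lemma kernelH_upper :
  kernel_upper (kernelH m I) (2 * 2 ^+ (3 * m.-1) * 2 ^+ (m.-1 * m.-1)).
Proof.
move=> rho d a rhoP d0 hI j k t s t0 ts s1 sa jk lj nlj nlk.
have s0 := lt_trans t0 ts.
have L1P := @L1norm_lattice_norm R.
have fL r : 0 <= r <= 1 -> fundr (@L1norm R) r = r.
  by move=> r01; rewrite /fundr fundfun_L1norm.
(* The dyadic index of [s] is its level for [L1norm], whose fundamental function is the identity. *)
have [n [[_ sn] nsn]] : exists n, level m (@L1norm R) n s /\ ~ level m (@L1norm R) n.+1 s.
  by apply: level_ex => //; rewrite s0.
have {nsn} := not_levelP s0 s1 nsn; move: sn.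
have s01 : 0 <= s <= 1 by rewrite !ltW.
rewrite !fL ?lexx ?ler01// !mul1r => sn /ltW ns.
have [e he] : exists e, 2^-1 ^+ (m * (n + e)) <= t.
  have [e he] := not_level_ex m0 L1P t0; exists e.
  have t1 : t < 1 := lt_trans ts s1.
  have := not_levelP t0 t1 he; rewrite !fL ?ler01 ?lexx ?(ltW t0) ?(ltW t1)// mul1r.
  move=> /ltW; apply: le_trans; rewrite ler_wiXn2l ?invr_ge0 ?invf_le1 ?ler1n//.
  by rewrite leq_mul2l leq_addl orbT.
have G := inner_upper rhoP d0 hI t0 (ltW ts) (ltW sa) s1 nlk he sn.
have II := invI_bound rhoP d0 hI s0 sa s1 nlj ns.
have Is0 := I0 s0 s1.
apply: (@le_trans _ _ ((d * 2 ^+ j.+1 * 2 ^+ (m.-1 * n.+1))%:E *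
   (2 * (d * 2 ^+ k.+1 * 2 ^+ m.-1) * 2^-1 ^+ n)%:E ^+ m.-1)%E).
  apply: lee_pmul.
  - by rewrite lee_fin mulr_ge0 ?invr_ge0// ltW.
  - by apply: expe_ge0; exact: inner_ge0.
  - rewrite lee_fin; apply: le_trans II; rewrite ler_piMl ?invr_ge0 ?(ltW Is0)//.
    by rewrite invf_le1 ?ltr0n ?fact_gt0// ler1n fact_gt0.
  - by apply: le_expe2r => //; exact: inner_ge0.
rewrite -EFin_expe -EFinM lee_fin !exprMn le_eqVlt; apply/orP; left; apply/eqP.
have -> : d ^+ m = d * d ^+ m.-1 by rewrite -exprS prednK.
rewrite -!exprM.
have -> : (n * m.-1 = m.-1 * n)%N by rewrite mulnC.
have -> : (k.+1 * m.-1 = m.-1 * k + m.-1)%N by rewrite mulnC mulnS addnC.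
have -> : (m.-1 * n.+1 = m.-1 * n + m.-1)%N by rewrite mulnS addnC.
have -> : (3 * m.-1 = m.-1 + m.-1 + m.-1)%N by rewrite !mulSn mul0n addn0 addnA.
rewrite !exprD !exprS.
transitivity (2 * (2 ^+ m.-1 * 2 ^+ m.-1 * 2 ^+ m.-1) * 2 ^+ (m.-1 * m.-1) * (d * d ^+ m.-1) *
  2 ^+ (m.-1 * k) * 2 ^+ j * (2^-1 ^+ (m.-1 * n) * 2 ^+ (m.-1 * n))); first by ring.
by rewrite pow2V mulr1.
Qed.

End KernelBounds.

(** * Layer-cake sums with a fixed step *)

Section LayerCake.
Context {R : realType}.
Local Notation leb := (@lebesgue_measure R).
Local Notation I01 := (@I01 R).
Implicit Types (a t x y e : R).

Lemma sum_ltn (K n : nat) : (\sum_(k < K) (k < n))%N = minn K n.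
Proof.
elim: K => [|K IH]; first by rewrite big_ord0 min0n.
by rewrite big_ord_recr /= IH; case: ltnP => h; lia.
Qed.

(** Layer [k] is counted exactly when [k] is below the integer part of [y / e]. The next two
    estimates bracket [y], up to truncation at height [K%:R * e], within one step [e]. *)
Lemma sum_layer_nat (K : nat) y e : 0 < e -> 0 <= y ->
  \sum_(k < K) (k.+1%:R * e <= y)%R%:R = (minn K (Num.truncn (y / e)))%:R :> R.
Proof.
move=> e0 y0; rewrite -sum_ltn natr_sum; apply: eq_bigr => k _; congr (_%:R).
by rewrite -ler_pdivlMr// truncn_gt_nat.
Qed.

Lemma sum_layer_le (K : nat) y e : 0 < e -> 0 <= y ->
  e * (\sum_(k < K) (k.+1%:R * e <= y)%R%:R) <= y.
Proof.
move=> e0 y0; rewrite sum_layer_nat// mulrC -ler_pdivlMr//.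
have ye : 0 <= y / e by rewrite divr_ge0// ltW.
apply: (@le_trans _ _ (Num.truncn (y / e))%:R); first by rewrite ler_nat geq_minr.
by have /andP[] := truncn_itv ye.
Qed.

Lemma sum_layer_ge (K : nat) y e : 0 < e -> 0 <= y ->
  Num.min y (K%:R * e) <= e + e * (\sum_(k < K) (k.+1%:R * e <= y)%R%:R).
Proof.
move=> e0 y0; rewrite sum_layer_nat//.
have ye : 0 <= y / e by rewrite divr_ge0// ltW.
have /andP[_ h] := truncn_itv ye.
rewrite ge_min; apply/orP; rewrite /minn; case: ltnP => _.
  by right; rewrite mulrC lerDr ltW.
left; move: h; rewrite ltr_pdivrMr// => /ltW h; apply: le_trans h _.
by rewrite -natr1 mulrDl mul1r addrC mulrC.
Qed.

(** By the Fatou property. The truncation heights are those of [sum_layer_ge], so each truncation is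
    covered by [K] layers of step [e]. *)
Lemma ln_truncation (rho : (R -> \bar R) -> \bar R) (f : R -> R) e (M : \bar R) :
  lattice_norm rho -> measurable_fun I01 f -> (forall x, 0 <= f x) -> 0 < e ->
  (forall K : nat, (rho (fun x => (Num.min (f x) (K%:R * e))%:E) <= M)%E) ->
  (rho (fun x => (f x)%:E) <= M)%E.
Proof.
move=> rhoP mf f0 e0 hM.
suff cv : (fun K : nat => rho (fun x => (Num.min (f x) (K%:R * e))%:E)) @ \oo
    --> rho (fun x => (f x)%:E).
  by apply: (cvge_to_le cv); exact: nearW.
apply: (ln_fatou rhoP).
- move=> K; apply: mpos_EFin; first exact: measurable_minr.
  by move=> x; rewrite le_min f0 mulr_ge0// ltW.
- exact: mpos_EFin.
- move=> x x01; split.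
    move=> k; rewrite lee_fin le_min !ge_min lexx /=; apply/orP; right.
    by rewrite ler_pM2r// ler_nat.
  apply: cvg_near_cst; exists (Num.truncn (f x / e)).+1 => // n /= hn.
  congr (_%:E); apply/min_idPl; rewrite -ler_pdivrMr//.
  have ye : 0 <= f x / e by rewrite divr_ge0// ltW.
  by have /andP[_ /ltW h] := truncn_itv ye; apply: le_trans h _; rewrite ler_nat.
Qed.

End LayerCake.

(** * Doubling of the fundamental function *)

Section Rearrangement.
Context {R : realType}.
Local Notation leb := (@lebesgue_measure R).
Local Notation I01 := (@I01 R).
Implicit Types (a t x y e l : R).
Variable rho : (R -> \bar R) -> \bar R.
Hypothesis rhoP : ri_norm rho.
Let lnP : lattice_norm rho := ri_norm_lattice_norm rhoP.

Lemma ri_indic (A : set R) t : measurable A -> A `<=` I01 -> 0 <= t <= 1 ->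
  leb A = t%:E -> rho (fun x => (\1_A x)%:E) = fundfun rho t.
Proof.
move=> mA A01 /andP[t0 t1] At; apply: (ri_rearr rhoP); try exact: mpos_indic.
move=> l.
have sub : `]0, t[%classic `<=` I01.
  move=> x /=; rewrite in_itv /= => /andP[x0 xt]; apply/I01E.
  by rewrite x0 (lt_le_trans xt).
have lt : leb `]0%R, t[ = t%:E by rewrite lebesgue_measure_itvE// subr0.
(* A superlevel set of an indicator is (0,1), the set itself or empty, according to the position of
   [l] relative to 0 and 1. *)
have E (B : set R) : B `<=` I01 ->
    (I01 `&` [set x | (l%:E < (\1_B x)%:E)%E]) =
    if l < 0 then I01 else if l < 1 then B else set0.
  move=> B01; apply/seteqP; split => [x [x01]|x] /=.
    rewrite lte_fin indicE; case: (pselect (B x)) => Bx.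
      by rewrite mem_set//; case: ifP => // _; case: ifP.
    by rewrite memNset// => ->.
  have [l0 x01|l0] := ltP l 0; first by split => //; rewrite lte_fin indicE (lt_le_trans l0).
  have [l1 Bx|//] := ltP l 1; split; first exact: B01.
  by rewrite lte_fin indicE mem_set.
rewrite !E//; case: ifP => // _; case: ifP => // _.
by rewrite At lt.
Qed.

(** The interval (0,2t) splits into (0,t) and [t,2t), whose indicators have the same norm. *)
Lemma fundfun_double t : 0 < t -> t + t <= 1 -> fundr rho (t + t) <= 2 * fundr rho t.
Proof.
move=> t0 t1; rewrite -lee_fin EFinM -!(fundrE lnP).
pose A : set R := `[t, t + t[%classic.
have mA : measurable A by exact: measurable_itv.
have A01 : A `<=` I01.
  move=> x; rewrite /A /= in_itv /= => /andP[tx xt]; apply/I01E.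
  by rewrite (lt_le_trans t0 tx) (lt_le_trans xt).
have lA : leb A = t%:E by rewrite /A lebesgue_measure_itvE ?addrK// lerDl ltW.
have RA : rho (fun x => (\1_A x)%:E) = fundfun rho t.
  by apply: ri_indic => //; apply/andP; split; lra.
rewrite mule_natl mule2n -{2}RA; apply: le_trans (ln_triangle lnP _ _);
  try exact: mpos_indic.
apply: ln_le => //; try by apply: mpos_indic.
  by apply: mposD; exact: mpos_indic.
move=> x /andP[x0 x1]; rewrite -EFinD lee_fin !indicE.
rewrite !mem_setE !in_itv /= x0 /=.
by have [xt|tx] := ltP x t; have [xtt|ttx] := ltP x (t + t); rewrite /= ?addr0 ?add0r ?ler01 ?lerDl.
Qed.

(** Testing on bumps yields the fundamental function at [a / 4]; this brings it back to [a]. *)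
Lemma fundfun_quarter a : 0 < a -> a <= 1 -> fundr rho a <= 4 * fundr rho (a / 4).
Proof.
move=> a0 a1.
have h1 : fundr rho (a / 4 + a / 4) <= 2 * fundr rho (a / 4).
  by apply: fundfun_double; lra.
have e1 : a / 4 + a / 4 = a / 2 by lra.
have h2 : fundr rho (a / 2 + a / 2) <= 2 * fundr rho (a / 2).
  by apply: fundfun_double; lra.
have e2 : a / 2 + a / 2 = a by lra.
rewrite e1 in h1; rewrite e2 in h2; lra.
Qed.

End Rearrangement.

(** * Step functions on equal cells and their cyclic shifts *)

Section Averaging.
Context {R : realType}.
Local Notation leb := (@lebesgue_measure R).
Local Notation I01 := (@I01 R).
Implicit Types (t x y e l : R).
Variable rho : (R -> \bar R) -> \bar R.
Hypothesis rhoP : ri_norm rho.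
Let lnP : lattice_norm rho := ri_norm_lattice_norm rhoP.

Section Cells.
Variables (a : R) (n : nat).
Hypotheses (a0 : 0 < a) (a1 : a < 1).

Definition cell (i : 'I_n.+1) : set R :=
  `](i%:R * a / n.+1%:R), (i.+1%:R * a / n.+1%:R)]%classic.

(** Addition in the index type is modulo [n.+1], so [c (i + j)] describes a cyclic permutation of
    the cells. *)
Definition step_fun (c : 'I_n.+1 -> R) (x : R) : \bar R :=
  (\sum_i (c i * \1_(cell i) x)%:E)%E.

Let cell_le (i : 'I_n.+1) : i%:R * a / n.+1%:R <= i.+1%:R * a / n.+1%:R.
Proof. by rewrite ler_pM2r ?invr_gt0 ?ltr0n// ler_pM2r// ler_nat. Qed.

Lemma cell_uniq (i j : 'I_n.+1) x : cell i x -> cell j x -> i = j.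
Proof.
rewrite /cell /= !in_itv /= => /andP[ix xi] /andP[jx xj].
have h (p q : nat) : p%:R * a / n.+1%:R < q%:R * a / n.+1%:R -> (p < q)%N.
  by rewrite ltr_pM2r ?invr_gt0 ?ltr0n// ltr_pM2r// ltr_nat.
have ij := h _ _ (lt_le_trans ix xj); have ji := h _ _ (lt_le_trans jx xi).
by apply/val_inj/eqP => /=; rewrite eqn_leq -ltnS ij -ltnS ji.
Qed.

Lemma cell_sub (i : 'I_n.+1) : cell i `<=` I01.
Proof.
move=> x; rewrite /cell /= in_itv /= => /andP[ix xi]; apply/I01E; apply/andP; split.
  by apply: le_lt_trans ix; rewrite !mulr_ge0 ?invr_ge0// ltW.
apply: le_lt_trans xi _; apply: le_lt_trans a1.
rewrite ler_pdivrMr ?ltr0n// mulrC ler_pM2l// ler_nat; exact: ltn_ord.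
Qed.

Lemma cell_cover x : 0 < x -> x < a -> exists i : 'I_n.+1, cell i x.
Proof.
move=> x0 xa.
have n0 : 0 < n.+1%:R :> R by rewrite ltr0n.
have ex : exists k : nat, x <= k.+1%:R * a / n.+1%:R.
  by exists n; rewrite mulrAC divff ?mul1r ?ltW// gt_eqF.
case: (ex_minnP ex) => k hk hmin.
have kn : (k < n.+1)%N.
  by rewrite ltnS; apply: hmin; rewrite mulrAC divff ?mul1r ?ltW// gt_eqF.
exists (Ordinal kn); rewrite /cell /= in_itv /= hk andbT.
case: k hk hmin kn => [|k] hk hmin kn; first by rewrite !mul0r.
by rewrite ltNge; apply/negP => /hmin; rewrite ltnn.
Qed.

Lemma step_fun_cell (c : 'I_n.+1 -> R) i x : cell i x -> step_fun c x = (c i)%:E.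
Proof.
move=> ix; rewrite /step_fun (bigD1 i)//= indicE mem_set// mulr1 big1 ?adde0// => j ji.
rewrite indicE memNset ?mulr0// => jx; move/eqP: ji; apply.
exact: cell_uniq jx ix.
Qed.

Lemma step_fun_out (c : 'I_n.+1 -> R) x : (forall i, ~ cell i x) -> step_fun c x = 0%E.
Proof.
by move=> h; rewrite /step_fun big1// => i _; rewrite indicE memNset ?mulr0.
Qed.

Let measurable_cell (i : 'I_n.+1) : measurable (cell i).
Proof. exact: measurable_itv. Qed.

Let lebesgue_cell (i : 'I_n.+1) : leb (cell i) = (a / n.+1%:R)%:E.
Proof.
rewrite /cell lebesgue_measure_itvE//; congr (_%:E).
by rewrite -!mulrA -mulrBl -natr1 addrAC subrr add0r mul1r.
Qed.

Lemma mpos_step_fun (c : 'I_n.+1 -> R) : (forall i, 0 <= c i) -> mpos (step_fun c).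
Proof.
move=> c0; split.
  apply: emeasurable_sum => i; apply/measurable_EFinP.
  by apply: measurable_funM => //; exact: measurable_indic.
by move=> x; apply: sume_ge0 => i _; rewrite lee_fin mulr_ge0.
Qed.

Lemma lebesgue_step_fun (c : 'I_n.+1 -> R) l : (forall i, 0 <= c i) -> 0 <= l ->
  leb (I01 `&` [set x | (l%:E < step_fun c x)%E]) =
  (\sum_i ((l < c i)%R%:R * (a / n.+1%:R))%:E)%E.
Proof.
move=> c0 l0; set S := (X in leb X).
(* The indicator of the superlevel set is again a step function; [0 <= l] excludes the points
   outside all cells, where [step_fun] is 0. *)
have SE (x : R) : (\1_S x)%:E = step_fun (fun i => (l < c i)%R%:R) x.
  case: (pselect (exists i, cell i x)) => [[i ix]|nx].
    rewrite (step_fun_cell _ ix); congr (_%:E); rewrite indicE.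
    suff -> : (x \in S) = (l < c i) by [].
    apply/idP/idP => [/set_mem[_] /=|li].
      by rewrite (step_fun_cell _ ix) lte_fin.
    apply/mem_set; split; first exact: cell_sub ix.
    by rewrite /= (step_fun_cell _ ix) lte_fin.
  have nx' i : ~ cell i x by move=> ix; apply: nx; exists i.
  rewrite (step_fun_out _ nx') indicE memNset// => -[_] /=.
  by rewrite (step_fun_out _ nx') lte_fin ltNge l0.
have mS : measurable S.
  by apply: emeasurable_fun_o_infty => //; case: (mpos_step_fun c0).
have -> : leb S = (\int[leb]_(x in I01) (\1_S x)%:E)%E.
  by rewrite integral_indic// setIidl// => x [].
under eq_integral do rewrite SE.
rewrite ge0_integral_sum//; last first.
  move=> i; apply/measurable_EFinP.
  by apply: measurable_funM => //; apply: measurable_indic; exact: measurable_cell.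
apply: eq_bigr => i _.
under eq_integral do rewrite EFinM.
rewrite ge0_integralZl_EFin//; last first.
  by apply/measurable_EFinP; apply: measurable_indic; exact: measurable_cell.
rewrite integral_indic//; last exact: measurable_cell.
rewrite setIidl; last exact: cell_sub.
by rewrite [X in (_ * X)%E]lebesgue_cell -EFinM.
Qed.

(** A shift only permutes the terms of [lebesgue_step_fun]; for [l < 0] both superlevel sets are
    (0,1). *)
Lemma rho_step_fun_shift (c : 'I_n.+1 -> R) (j : 'I_n.+1) : (forall i, 0 <= c i) ->
  rho (step_fun (fun i => c (i + j))) = rho (step_fun c).
Proof.
move=> c0; apply: (ri_rearr rhoP); try by apply: mpos_step_fun => i.
move=> l; have [l0|l0] := ltP l 0.
  have E (d : 'I_n.+1 -> R) : (forall i, 0 <= d i) ->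
      I01 `&` [set x | (l%:E < step_fun d x)%E] = I01.
    move=> d0; apply: setIidl => x _ /=; apply: (@lt_le_trans _ _ 0%E).
      by rewrite lte_fin.
    by case: (mpos_step_fun d0).
  by rewrite !E.
rewrite !lebesgue_step_fun//.
by rewrite [RHS](reindex_inj (addIr j)).
Qed.

(** The [n.+1] shifts have equal norms and add up on (0,a) to the constant [\sum_i c i]; the
    triangle inequality concludes. *)
Lemma step_fun_average (c : 'I_n.+1 -> R) : (forall i, 0 <= c i) ->
  (((\sum_i c i) * fundr rho a)%:E <= n.+1%:R%:E * rho (step_fun c))%E.
Proof.
move=> c0; pose h (k : nat) := step_fun (fun i => c (i + inord k)).
have mh k : mpos (h k) by apply: mpos_step_fun => i.
have Sc0 : 0 <= \sum_i c i by apply: sumr_ge0.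
apply: (@le_trans _ _ (rho (fun x => \sum_(k < n.+1) h k x)%E)).
  rewrite EFinM -fundrE// -(ln_homog lnP)//; last exact: mpos_indic.
  apply: ln_le => //; first by apply: mposZ => //; exact: mpos_indic.
    exact: mpos_sum.
  move=> x /andP[x0 x1]; have [xa|ax] := ltP x a; last first.
    rewrite indicE memNset ?mule0; last by rewrite /= in_itv /= (ltNge x) ax andbF.
    by apply: sume_ge0 => k _; case: (mh k).
  rewrite indicE mem_set ?mule1; last by rewrite /= in_itv /= x0.
  have [i ix] := cell_cover x0 xa.
  have hE k : h k x = (c (i + inord k))%:E := step_fun_cell _ ix.
  under [X in (_ <= X)%E]eq_bigr => k _ do rewrite hE inord_val.
  rewrite sumEFin lee_fin.
  by rewrite [leLHS](reindex_inj (addrI i)).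
apply: (le_trans (ln_sum lnP _ mh)).
under eq_bigr do rewrite rho_step_fun_shift//.
by rewrite sumr_const card_ord mule_natl.
Qed.

End Cells.

End Averaging.

(** * Rearrangement of layered functions and the averaging bound on (0,a) *)

Section LayerRearrangement.
Context {R : realType}.
Local Notation leb := (@lebesgue_measure R).
Local Notation I01 := (@I01 R).
Implicit Types (t x y e l a : R).

Let leb_le (A B : set R) : measurable A -> measurable B -> A `<=` B ->
  (leb A <= leb B)%E.
Proof. by move=> mA mB AB; apply: le_measure => //; rewrite inE. Qed.

Definition layer_fun e (K : nat) (E : nat -> set R) (x : R) : R :=
  e * \sum_(k < K) \1_(E k) x.

Lemma measurable_layer_fun e K (E : nat -> set R) : (forall k, measurable (E k)) ->
  measurable_fun I01 (layer_fun e K E).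
Proof.
move=> mE; apply: measurable_funM => //; apply: measurable_sum => k.
exact: measurable_indic.
Qed.

Lemma layer_fun_ge0 e K (E : nat -> set R) x : 0 < e -> 0 <= layer_fun e K E x.
Proof. by move=> e0; rewrite mulr_ge0 ?(ltW e0)// sumr_ge0. Qed.

Lemma mpos_layer_fun e K (E : nat -> set R) : (forall k, measurable (E k)) -> 0 < e ->
  mpos (fun x => (layer_fun e K E x)%:E).
Proof.
move=> mE e0; apply: mpos_EFin; first exact: measurable_layer_fun.
by move=> x; exact: layer_fun_ge0.
Qed.

(** A count of layers exceeds [l / e] exactly when it exceeds its integer part [j]; the layers being
    nested, [x] lies in more than [j] of the first [K] exactly when [j < K] and [x] is in [E j]. *)
Lemma layer_fun_level e K (E : nat -> set R) l : 0 < e -> 0 <= l ->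
  (forall k, E k `<=` I01) -> (forall j k, (j <= k)%N -> E k `<=` E j) ->
  I01 `&` [set x | (l%:E < (layer_fun e K E x)%:E)%E] =
  if (Num.truncn (l / e) < K)%N then E (Num.truncn (l / e)) else set0.
Proof.
move=> e0 l0 E01 nested; set j := Num.truncn _.
have le0 : 0 <= l / e by rewrite divr_ge0// ltW.
have /andP[jl lj] := truncn_itv le0; rewrite -/j in jl lj.
have cnt x : layer_fun e K E x = e * (\sum_(k < K) (x \in E k))%N%:R.
  by rewrite /layer_fun natr_sum; congr (_ * _); apply: eq_bigr.
have lecnt (n : nat) : (l < e * n%:R) = (j < n)%N.
  apply/idP/idP => [|jn].
    rewrite mulrC -ltr_pdivrMr// => h.
    by rewrite -(ltr_nat R) (le_lt_trans jl).
  rewrite mulrC -ltr_pdivrMr//; apply: lt_le_trans lj _; by rewrite ler_nat.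
apply/seteqP; split => [x [x01 /=]|x].
  rewrite lte_fin cnt lecnt// => h.
  have jK : (j < K)%N.
    apply: leq_trans h _; rewrite -[leqRHS]muln1 -[X in (X * 1)%N]card_ord -sum_nat_const.
    by apply: leq_sum => k _; case: (_ \in _).
  rewrite jK; apply: contrapT => nEj; move: h; apply/negP; rewrite -leqNgt.
  apply: (@leq_trans (\sum_(k < K) (k < j))); last by rewrite sum_ltn geq_minr.
  apply: leq_sum => k _; have [//|jk] := ltnP k j; first by case: (_ \in _).
  by rewrite memNset// => /(nested _ _ jk).
case: ifPn => [jK Ejx|//]; split; first exact: E01 Ejx.
rewrite /= lte_fin cnt lecnt//.
apply: (@leq_trans (\sum_(k < K) (k < j.+1))); first by rewrite sum_ltn leq_min jK ltnSn.
apply: leq_sum => k _; case: ltnP => // kj.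
by rewrite mem_set//; exact: nested Ejx.
Qed.

Lemma layer_fun_rearr (rho : (R -> \bar R) -> \bar R) e K (E E' : nat -> set R) :
  ri_norm rho -> 0 < e ->
  (forall k, measurable (E k)) -> (forall k, measurable (E' k)) ->
  (forall k, E k `<=` I01) -> (forall k, E' k `<=` I01) ->
  (forall j k, (j <= k)%N -> E k `<=` E j) ->
  (forall j k, (j <= k)%N -> E' k `<=` E' j) ->
  (forall k, leb (E k) = leb (E' k)) ->
  rho (fun x => (layer_fun e K E x)%:E) = rho (fun x => (layer_fun e K E' x)%:E).
Proof.
move=> rhoP e0 mE mE' sE sE' nE nE' EE'.
apply: (ri_rearr rhoP); try exact: mpos_layer_fun.
move=> l; have [l0|l0] := ltP l 0; last first.
  by rewrite !layer_fun_level//; case: ifP => // _; rewrite EE'.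
rewrite !setIidl// => x _ /=; rewrite lte_fin (lt_le_trans l0)//; exact: layer_fun_ge0.
Qed.

Section AveragingLemma.
Variables (rho : (R -> \bar R) -> \bar R) (f : R -> R) (a : R).
Hypotheses (rhoP : ri_norm rho) (mf : measurable_fun I01 f) (f0 : forall x, 0 <= f x).
Hypotheses (a0 : 0 < a) (a1 : a < 1) (rf : (rho (fun x => (f x)%:E) <= 1)%E).
Let lnP : lattice_norm rho := ri_norm_lattice_norm rhoP.

Let E e (k : nat) : set R := `]0, a[%classic `&` [set x | k.+1%:R * e <= f x].

Let sub0a : `]0, a[%classic `<=` I01.
Proof.
by move=> x; rewrite /= in_itv /= => /andP[x0 xa]; apply/I01E; rewrite x0 (lt_trans xa).
Qed.

Let mE e k : measurable (E e k).
Proof.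
have -> : E e k = `]0, a[%classic `&` (I01 `&` [set x | (k.+1%:R * e)%:E <= (f x)%:E]%E).
  apply/seteqP; split => x /= [xa]; rewrite lee_fin => h; split => //.
    by split => //; exact: sub0a.
  by case: h.
apply: measurableI => //; apply: emeasurable_fun_c_infty => //.
exact/measurable_EFinP.
Qed.

Let E01 e k : E e k `<=` I01.
Proof. by move=> x [xa _]; exact: sub0a. Qed.

Let nestedE e : 0 < e -> forall j k, (j <= k)%N -> E e k `<=` E e j.
Proof.
move=> e0 j k jk x [xa fx]; split => //=; apply: le_trans fx.
by rewrite ler_pM2r// ler_nat.
Qed.

Let u e k : R := fine (leb (E e k)).

Let uE e k : leb (E e k) = (u e k)%:E.
Proof.
rewrite /u fineK// ge0_fin_numE//; apply: (@le_lt_trans _ _ (leb `]0%R, a[)).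
  by apply: leb_le => // x [].
by rewrite lebesgue_measure_itvE ?ltry// ltW.
Qed.

Let u_ge0 e k : 0 <= u e k. Proof. exact: fine_ge0. Qed.

Let u_le e k : u e k <= a.
Proof.
rewrite -lee_fin -uE.
apply: (@le_trans _ _ (leb `]0%R, a[)).
  by apply: leb_le => // x [].
by rewrite lebesgue_measure_itvE ?(ltW a0)// subr0.
Qed.

Let u_ni e : 0 < e -> forall j k, (j <= k)%N -> u e k <= u e j.
Proof.
move=> e0 j k jk; rewrite -lee_fin -!uE; apply: leb_le => //.
exact: nestedE.
Qed.

(** The layered minorant of [f] on (0,a) is rearranged onto the intervals [E' k]. The resulting
    decreasing function dominates the step function of its values at the right ends of the cells, to
    which [step_fun_average] applies. Each layer loses at most one cell, whence the [n.+1%:R^-1]. *)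
Let layer_sum_n e (K n : nat) : 0 < e ->
  e * (\sum_(k < K) (u e k / a - n.+1%:R^-1)) * fundr rho a <= 1.
Proof.
move=> e0; pose N : R := n.+1%:R; have N0 : 0 < N by rewrite ltr0n.
pose c (i : 'I_n.+1) : R := e * \sum_(k < K) (i.+1%:R * a / N <= u e k)%R%:R.
have c0 i : 0 <= c i by rewrite mulr_ge0 ?(ltW e0)// sumr_ge0.
pose E' k : set R := `]0, u e k]%classic.
have mE' k : measurable (E' k) by exact: measurable_itv.
have h1 : (rho (step_fun a c) <= 1)%E.
  apply: (@le_trans _ _ (rho (fun x => (layer_fun e K E' x)%:E))).
    apply: ln_le => //; [exact: mpos_step_fun|exact: mpos_layer_fun|move=> x x01].
    case: (pselect (exists i : 'I_n.+1, cell a i x)) => [[i ix]|nx]; last first.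
      rewrite step_fun_out; first by rewrite lee_fin layer_fun_ge0.
      by move=> i ix; apply: nx; exists i.
    rewrite (step_fun_cell a0 _ ix) lee_fin ler_pM2l//; apply: ler_sum => k _.
    rewrite indicE ler_nat; case: (boolP (_ <= u e k)) => // iu.
    rewrite mem_set//; move: ix; rewrite /cell /E' /= !in_itv /= => /andP[_ xi].
    by case/andP: x01 => -> _ /=; exact: le_trans xi iu.
  rewrite -(@layer_fun_rearr rho e K (E e) E')//.
  - apply: le_trans rf; apply: ln_le => //; [exact: mpos_layer_fun|exact: mpos_EFin|].
    move=> x x01; rewrite lee_fin; apply: le_trans (sum_layer_le K e0 (f0 x)).
    rewrite ler_pM2l//; apply: ler_sum => k _; rewrite indicE ler_nat.
    by case: (boolP (x \in E e k)) => // /set_mem[_ /= ->].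
  - move=> k x; rewrite /E' /= in_itv /= => /andP[x0 xu]; apply/I01E.
    by rewrite x0 (le_lt_trans xu)// (le_lt_trans (u_le e k)).
  - exact: nestedE.
  - move=> j k jk x; rewrite /E' /= !in_itv /= => /andP[-> xu] /=.
    by apply: le_trans xu _; exact: u_ni.
  - by move=> k; rewrite uE /E' (lebesgue_measure_itvE _ _ (u_ge0 e k)) subr0.
have h2 := step_fun_average rhoP a0 a1 c0.
have h3 : (\sum_i c i) * fundr rho a <= N.
  rewrite -lee_fin; apply: (le_trans h2); rewrite -[leRHS]mule1.
  by apply: lee_wpmul2l => //; rewrite lee_fin.
(* Exchange the sums: layer [k] contains as many whole cells as the integer part of
   [N * (u e k / a)], and [u e k <= a] keeps this within the [n.+1] cells available. *)
have h4 : N * (e * \sum_(k < K) (u e k / a - N^-1)) <= \sum_i c i.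
  rewrite /c -mulr_sumr mulrCA ler_pM2l// exchange_big /= mulr_sumr.
  apply: ler_sum => k _; rewrite mulrBr divff ?gt_eqF//.
  have y0 : 0 <= N * (u e k / a) by rewrite mulr_ge0 ?divr_ge0 ?(ltW a0) ?(ltW N0).
  apply: (@le_trans _ _ (Num.truncn (N * (u e k / a)))%:R).
    have /andP[_ /ltW] := truncn_itv y0; by rewrite -natr1 lerBlDr.
  rewrite (_ : Num.truncn _ = minn n.+1 (Num.truncn (N * (u e k / a)))); last first.
    apply/esym/minn_idPr; rewrite -(ler_nat R).
    apply: (@le_trans _ _ (N * (u e k / a))); first by rewrite truncn_le.
    by rewrite -[leRHS]mulr1 ler_pM2l// ler_pdivrMr// mul1r.
  rewrite -sum_ltn natr_sum; apply: ler_sum => i _.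
  rewrite truncn_gt_nat ler_nat.
  case: (boolP (i.+1%:R <= _)) => // hi; rewrite (_ : _ <= u e k)//.
  rewrite ler_pdivrMr// -ler_pdivlMr//; apply: le_trans hi _.
  by rewrite mulrA [N * _]mulrC.
have p0 : 0 < fundr rho a by exact: fundr_gt0.
rewrite -(ler_pM2l N0) mulr1 mulrA; apply: le_trans h3.
by rewrite ler_pM2r.
Qed.

Let layer_sum e (K : nat) : 0 < e ->
  e * (\sum_(k < K) u e k) <= a / fundr rho a.
Proof.
move=> e0; have p0 : 0 < fundr rho a by exact: fundr_gt0.
rewrite ler_pdivlMr// -[leRHS]mulr1 -ler_pdivrMl//.
apply/ler_addgt0Pr => d d0.
(* With [e] and [K] fixed, the error left by [layer_sum_n] is [c / n.+1%:R], and [n] is chosen to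
   bring it below [d]. *)
set c := e * K%:R * fundr rho a.
have c0 : 0 <= c by rewrite !mulr_ge0 ?(ltW e0) ?(ltW p0).
have [n hn] : exists n : nat, c / n.+1%:R <= d.
  exists (Num.truncn (c / d)).
  have cd0 : 0 <= c / d by rewrite divr_ge0// ltW.
  have /andP[_ /ltW h] := truncn_itv cd0.
  by rewrite ler_pdivrMr ?ltr0n// mulrC -ler_pdivrMr.
have := layer_sum_n K n e0.
rewrite sumrB sumr_const card_ord -mulr_suml -mulr_natr => h.
rewrite -(lerD2r (- (c / n.+1%:R))).
apply: le_trans (_ : _ <= 1) _; last by rewrite -addrA lerDl subr_ge0.
apply: le_trans h; rewrite le_eqVlt; apply/orP; left; apply/eqP.
rewrite /c; field; rewrite ?gt_eqF// ?ltr0n//.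
Qed.

(** Layers of step [e] miss a truncation of [f] by at most [e] at each point of (0,a), that is by
    [e * a = d] in the integral; [layer_sum] bounds the layers and [ln_truncation] removes the
    truncation. *)
Lemma integral_le_fundr :
  (\int[leb]_(x in I01) (\1_(`]0, a[%classic) x * f x)%:E <= (a / fundr rho a)%:E)%E.
Proof.
pose g x := \1_(`]0, a[%classic) x * f x.
have mg : measurable_fun I01 g by apply: measurable_funM => //; exact: measurable_indic.
have g0 x : 0 <= g x by rewrite mulr_ge0.
apply/lee_addgt0Pr => d d0.
have L1P := @L1norm_lattice_norm R.
rewrite -(@L1normE _ (fun x => (g x)%:E)); last by move=> x _; rewrite lee_fin.
pose e := d / a; have e0 : 0 < e by rewrite divr_gt0.
apply: (ln_truncation L1P mg g0 e0) => K.
pose h x : \bar R := ((e%:E * (\1_(`]0, a[%classic) x)%:E) + (layer_fun e K (E e) x)%:E)%E.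
have mi : mpos (fun x => (\1_(`]0, a[%classic) x)%:E) by exact: mpos_indic.
apply: (@le_trans _ _ (L1norm h)).
  apply: ln_le => //.
  - apply: mpos_EFin; first exact: measurable_minr.
    by move=> x; rewrite le_min g0 mulr_ge0// ltW.
  - by apply: mposD; [apply: mposZ => //; exact: ltW|exact: mpos_layer_fun].
  move=> x x01; rewrite /h /g; case: (pselect (`]0, a[%classic x)) => xa.
    rewrite indicE mem_set// mul1r mule1 -EFinD lee_fin.
    apply: le_trans (sum_layer_ge K e0 (f0 x)) _; rewrite lerD2l ler_pM2l//.
    apply: ler_sum => k _; rewrite indicE ler_nat; case: (boolP (_ <= f x)) => // fx.
    by rewrite mem_set.
  rewrite indicE memNset// mul0r mule0 add0e lee_fin.
  apply: (@le_trans _ _ 0); first by rewrite ge_min lexx.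
  exact: layer_fun_ge0.
apply: (le_trans (ln_triangle L1P _ _)).
- by apply: mposZ => //; exact: ltW.
- exact: mpos_layer_fun.
rewrite addeC; apply: leeD; last first.
  rewrite (ln_homog L1P)//; last exact: ltW.
  rewrite -[X in (_ * X)%E]/(fundfun (@L1norm R) a) fundfun_L1norm; last by rewrite !ltW.
  by rewrite -EFinM lee_fin /e divfK ?gt_eqF.
rewrite (_ : (fun x => _) = (fun x => e%:E * (\sum_(k < K) (\1_(E e k) x)%:E))%E); last first.
  by apply/funext => x; rewrite sumEFin -EFinM.
have mS : mpos (fun x => \sum_(k < K) (\1_(E e k) x)%:E)%E.
  by apply: (mpos_sum _ (h := fun k x => (\1_(E e k) x)%:E)) => k; exact: mpos_indic.
rewrite (ln_homog L1P)//; last exact: ltW.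
apply: (@le_trans _ _ (e%:E * (\sum_(k < K) u e k)%:E)%E); last first.
  by rewrite -EFinM lee_fin; exact: layer_sum.
apply: lee_wpmul2l; first by rewrite lee_fin ltW.
apply: (le_trans (ln_sum L1P K (h := fun k x => (\1_(E e k) x)%:E) _)).
  by move=> k; exact: mpos_indic.
rewrite -sumEFin; apply: lee_sum => k _.
rewrite L1normE; last by move=> x _; rewrite lee_fin.
rewrite integral_indic//; last exact: mE.
by rewrite setIidl; [rewrite [leLHS]uE|exact: E01].
Qed.

End AveragingLemma.
End LayerRearrangement.

(** * Equality of X and L^1 as linear growth of the fundamental function *)

Section EqualityWithL1.
Context {R : realType}.
Local Notation leb := (@lebesgue_measure R).
Local Notation I01 := (@I01 R).
Variable rho : (R -> \bar R) -> \bar R.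
Hypothesis rhoP : ri_norm rho.
Let lnP : lattice_norm rho := ri_norm_lattice_norm rhoP.

(** With layers of step 1, the norm of [f] is at most that of 1 plus the sum of [fundr rho (u k)],
    where [u k] is the measure of the k-th layer; the sum of the [u k] is at most the integral of
    [|f|]. The other implication is [ri_L1]. *)
Lemma X_is_L1_of_fundr (C : R) : 0 <= C ->
  (forall t, 0 < t < 1 -> fundr rho t <= C * t) -> X_is_L1 rho.
Proof.
move=> C0 hC.
(* A layer may have measure 0 or 1: at 0 the indicator vanishes, and 1 is reached from 1/2 by
   doubling. *)
have hC1 t : 0 <= t <= 1 -> fundr rho t <= C * t.
  move=> /andP[]; rewrite le_eqVlt => /orP[/eqP<- _|t0].
    rewrite mulr0 /fundr (_ : fundfun rho 0 = 0%E)//.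
    rewrite /fundfun (_ : (fun x => _) = (fun _ => 0%E)) ?(ln0 lnP)//.
    by apply/funext => x; rewrite set_itv_ge ?indic0// bnd_simp ltxx.
  rewrite le_eqVlt => /orP[/eqP->|t1]; last by apply: hC; rewrite t0.
  have h : 2^-1 + 2^-1 = 1 :> R by lra.
  have := @fundfun_double _ _ rhoP (2^-1 : R); rewrite h => /(_ _ (lexx _)) h1.
  have h2 : fundr rho 2^-1 <= C * 2^-1 by apply: hC; apply/andP; split; lra.
  by rewrite mulr1; apply: (le_trans (h1 _)); lra.
move=> f mf; have mpf := mpos_abs mf.
split=> [rf|intf].
  have [C' hC'] := ri_L1 rhoP; apply: le_lt_trans (hC' _ mpf) _.
  have fin : rho (fun x => `|f x|%:E) \is a fin_num.
    by rewrite ge0_fin_numE// (ri_ge0 rhoP).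
  by rewrite -(fineK fin) -EFinM ltry.
pose E (k : nat) : set R := I01 `&` [set x | (k.+1%:R * 1)%:E <= `|f x|%:E]%E.
have mE k : measurable (E k) by apply: emeasurable_fun_c_infty => //; case: mpf.
have E01 k : E k `<=` I01 by move=> x [].
pose u k := fine (leb (E k)).
have leb1 k : (leb (E k) <= 1)%E.
  apply: (@le_trans _ _ (leb I01)).
    by apply: le_measure => //; rewrite inE//; exact: mE.
  by rewrite [leLHS]lebesgue_measure_itvE// subr0.
have uE k : leb (E k) = (u k)%:E.
  by rewrite /u fineK// ge0_fin_numE//; apply: le_lt_trans (leb1 k) (ltry _).
have u01 k : 0 <= u k <= 1 by rewrite /u fine_ge0//= -lee_fin -uE.
have rE k : rho (fun x => (\1_(E k) x)%:E) = (fundr rho (u k))%:E.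
  by rewrite -(fundrE lnP); exact: ri_indic.
apply: (@le_lt_trans _ _ (rho (fun=> 1%E) + C%:E * \int[leb]_(x in I01) `|f x|%:E)%E).
  apply: (ln_truncation lnP (f := fun x => `|f x|) _ _ ltr01) => //.
    exact: measurableT_comp.
  move=> K.
  pose S (x : R) : \bar R := (\sum_(k < K) (\1_(E k) x)%:E)%E.
  have mS : mpos S.
    by apply: (mpos_sum _ (h := fun k x => (\1_(E k) x)%:E)) => k; exact: mpos_indic.
  apply: (@le_trans _ _ (rho (fun x => 1%E + S x)%E)).
    apply: ln_le => //.
    - apply: mpos_EFin; first by apply: measurable_minr => //; exact: measurableT_comp.
      by move=> x; rewrite le_min normr_ge0 mulr1 ler0n.
    - by apply: mposD => //; exact: mpos1.
    move=> x /I01E x01; rewrite /S sumEFin -EFinD lee_fin.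
    apply: le_trans (sum_layer_ge K ltr01 (normr_ge0 (f x))) _.
    rewrite lerD2l mul1r; apply: ler_sum => k _; rewrite indicE ler_nat.
    by case: (boolP (_ <= `|f x|)) => // fx; rewrite mem_set.
  apply: (le_trans (ln_triangle lnP (@mpos1 R) mS)); apply: leeD2l.
  apply: (le_trans (ln_sum lnP K (h := fun k x => (\1_(E k) x)%:E) _)).
    by move=> k; exact: mpos_indic.
  apply: (@le_trans _ _ (C%:E * \sum_(k < K) (u k)%:E)%E).
    rewrite sumEFin -EFinM mulr_sumr -sumEFin; apply: lee_sum => k _.
    by rewrite rE lee_fin hC1.
  apply: lee_wpmul2l; first by rewrite lee_fin.
  have -> : (\sum_(k < K) (u k)%:E = \int[leb]_(x in I01) S x)%E.
    rewrite ge0_integral_sum//; last by move=> k; case: (mpos_indic (mE k)).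
    apply: eq_bigr => k _; rewrite integral_indic//; last exact: mE.
    by rewrite setIidl; [rewrite [RHS]uE|exact: E01].
  apply: ge0_le_integral => //; [by move=> x _; case: mS|by case: mS|by case: mpf|].
  move=> x _; rewrite /S sumEFin lee_fin.
  apply: le_trans (sum_layer_le K ltr01 (normr_ge0 (f x))).
  rewrite mul1r; apply: ler_sum => k _; rewrite indicE ler_nat.
  by case: (boolP (x \in E k)) => // /set_mem[_ /=]; rewrite lee_fin => ->.
rewrite lte_add_pinfty// ?(ri_one rhoP)//; apply: lte_mul_pinfty => //.
Qed.

(** If no [C] works, there are points [t n] with [4 ^+ n * t n < fundr rho (t n)]. The sum of the
    indicators of (0, [t n]) with weights [2^-1 ^+ n / t n] has integral at most 2, yet its norm is
    at least [2 ^+ n] for every [n]. *)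
Lemma fundr_of_X_is_L1 : X_is_L1 rho ->
  exists2 C : R, 0 < C & forall t, 0 < t < 1 -> fundr rho t <= C * t.
Proof.
move=> XL1; apply: contrapT => H.
have ht (n : nat) : exists t : R, 0 < t < 1 /\ 4 ^+ n * t < fundr rho t.
  apply: contrapT => H'; apply: H; exists (4 ^+ n); first by rewrite exprn_gt0.
  move=> t t01; rewrite leNgt; apply/negP => h; apply: H'; by exists t.
have [t /all_and2[t01 tn]] := choice ht.
have t0 n : 0 < t n by case/andP: (t01 n).
have t1 n : t n < 1 by case/andP: (t01 n).
pose h (n : nat) (x : R) : \bar R :=
  ((2^-1 ^+ n / t n)%:E * (\1_(`]0%R, t n[%classic) x)%:E)%E.
have c0 n : 0 <= 2^-1 ^+ n / t n by rewrite divr_ge0 ?exprn_ge0 ?invr_ge0// ltW.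
have mh n : mpos (h n) by apply: mposZ => //; exact: mpos_indic.
pose g x := (\sum_(n <oo) h n x)%E.
have mg : mpos g.
  split; last by move=> x; apply: nneseries_ge0 => n _ _; case: (mh n).
  by apply: ge0_emeasurable_sum => n; case: (mh n).
have ig : (\int[leb]_(x in I01) g x <= 2%:E)%E.
  rewrite integral_nneseries//; [|by move=> n; case: (mh n)|by move=> n x _; case: (mh n)].
  under eq_eseriesr => n _.
    rewrite -L1normE; last by move=> x _; case: (mh n).
    rewrite (ln_homog (@L1norm_lattice_norm R))//; last exact: mpos_indic.
    rewrite -[X in (_ * X)%E]/(fundfun (@L1norm R) (t n)).
    rewrite fundfun_L1norm ?(ltW (t0 n)) ?(ltW (t1 n))// -EFinM.
    rewrite mulfVK ?gt_eqF//; over.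
  apply: lime_le; first by apply: is_cvg_nneseries => n _ _; rewrite lee_fin exprn_ge0 ?invr_ge0.
  apply: nearW => n; rewrite sumEFin lee_fin.
  have -> : \sum_(0 <= i < n) 2^-1 ^+ i = series (geometric (1 : R) 2^-1) n.
    by apply: eq_bigr => i _; rewrite /= mul1r.
  apply: le_trans (geometric_le_lim _ _ _ _) _ => //; rewrite ?invr_gt0//.
    by rewrite ger0_norm ?invr_ge0// invf_lt1 ?ltr1n.
  by rewrite mul1r invf_ple ?posrE; lra.
(* [X_is_L1] concerns real-valued functions; [g] may be infinite, but being integrable it equals [f]
   almost everywhere. *)
pose f x := fine (g x).
have mf : measurable_fun I01 f.
  by apply: measurableT_comp; [exact: fine_measurable|case: mg].
have gfin : {ae leb, forall x, I01 x -> g x \is a fin_num}.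
  apply: integrable_ae => //; apply/integrableP; split; first by case: mg.
  apply: le_lt_trans (ltry 2); apply: le_trans ig; rewrite le_eqVlt; apply/orP; left.
  by apply/eqP; apply: eq_integral => x _; rewrite gee0_abs//; case: mg.
have fg x : (`|f x|%:E <= g x)%E.
  have gx : (0 <= g x)%E by case: mg.
  rewrite /f ger0_norm ?fine_ge0//; case: (g x) gx => //= _; exact: leey.
have rf : (rho (fun x => `|f x|%:E) < +oo)%E.
  apply/(XL1 _ mf); apply: le_lt_trans (ltry 2); apply: le_trans ig.
  apply: ge0_le_integral => //; [|by case: mg].
  by case: (mpos_abs mf).
have lb n : ((2 ^+ n)%:E <= rho (fun x => `|f x|%:E))%E.
  apply: (@le_trans _ _ (rho g)); last first.
    apply: (ln_lattice lnP) => //; first exact: mpos_abs.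
    have [N [mN N0 sN]] := gfin; exists N; split => // x nx; apply: sN => /= fin.
    apply: nx => /= x01; by rewrite /f ger0_norm ?fineK ?fin// fine_ge0//; case: mg.
  apply: (@le_trans _ _ (rho (h n))); last first.
    apply: ln_le => // x _; rewrite /g.
    apply: le_trans (nneseries_lim_ge n.+1 _); last by move=> k _ _; case: (mh k).
    rewrite big_nat_recr//=; apply: leeDr; apply: sume_ge0 => k _; by case: (mh k).
  rewrite (ln_homog lnP)//; last exact: mpos_indic.
  rewrite -[X in (_ * X)%E]/(fundfun rho (t n)) (fundrE lnP) -EFinM lee_fin.
  apply: (@le_trans _ _ (2^-1 ^+ n / t n * (4 ^+ n * t n))).
    rewrite mulrACA mulVf ?gt_eqF// mulr1 -exprMn.
    by rewrite (_ : 2^-1 * 4 = 2 :> R)//; lra.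
  by apply: ler_wpM2l => //; exact/ltW/tn.
have fin : rho (fun x => `|f x|%:E) \is a fin_num.
  by rewrite ge0_fin_numE// (ri_ge0 rhoP)//; exact: mpos_abs.
pose M := fine (rho (fun x => `|f x|%:E)).
have M0 : 0 <= M by apply: fine_ge0; apply: (ri_ge0 rhoP); exact: mpos_abs.
have := lb (Num.truncn M).+1; rewrite -(fineK fin) -/M lee_fin leNgt => /negP; apply.
have /andP[_ h1] := truncn_itv M0; apply: lt_le_trans h1 _.
by rewrite -natrX ler_nat ltnW// ltn_expl.
Qed.

End EqualityWithL1.

(** * Restricted operator norms and their limits *)

Section MainEstimates.
Context {R : realType}.

Definition sup_norm_restr (T : (R -> R) -> R -> \bar R)
    (N : (R -> \bar R) -> \bar R) (B : set (R -> R)) (a : R) : \bar R :=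
  ereal_sup [set N (T (restr a f)) | f in B].

Definition fund_ratio (m : nat) (I : R -> R) (rho : (R -> \bar R) -> \bar R)
    (a : R) : \bar R :=
  ((a ^+ m.-1 / I a ^+ m)%:E * fundfun rho a)%E.

Local Notation leb := (@lebesgue_measure R).
Local Notation I01 := (@I01 R).
Variables (m : nat) (I : R -> R) (Ker : R -> R -> \bar R) (CK cK : R).
Hypotheses (m0 : (0 < m)%N) (I_gt0 : forall t, 0 < t <= 1 -> 0 < I t).
Hypotheses (KerP : admissible_kernel Ker) (CK0 : 0 < CK) (cK0 : 0 < cK).
Hypotheses (KerU : kernel_upper m I Ker CK) (KerL : kernel_lower m I Ker cK).
Implicit Types (f : R -> R) (a d e s t : R).

Let I0 s : 0 < s -> s < 1 -> 0 < I s.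
Proof. by move=> s0 s1; apply: I_gt0; rewrite s0 ltW. Qed.

Lemma measurable_restr a f : measurable_fun I01 f -> measurable_fun I01 (restr a f).
Proof. by move=> mf; apply: measurable_funM => //; exact: measurable_indic. Qed.

Lemma restr_le a f x : `|restr a f x| <= `|f x|.
Proof. by rewrite /restr normrM indicE; case: (_ \in _); rewrite ?normr1 ?mul1r// normr0 mul0r. Qed.

Lemma integral_restr_le a f : measurable_fun I01 f ->
  (\int[leb]_(x in I01) `|restr a f x|%:E <= \int[leb]_(x in I01) `|f x|%:E)%E.
Proof.
move=> mf; apply: ge0_le_integral => //.
- by case: (mpos_abs (measurable_restr a mf)).
- by case: (mpos_abs mf).
- by move=> x _; rewrite lee_fin restr_le.
Qed.

Lemma norm_kernel_op_le (rho : (R -> \bar R) -> \bar R) f d a :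
  lattice_norm rho -> measurable_fun I01 f -> 0 < d ->
  (forall s, 0 < s -> s < a -> s < 1 ->
     s ^+ m.-1 * fundr rho s <= d ^+ m * fundr rho 1 * I s ^+ m) ->
  (rho (kernel_op Ker (restr a f)) <=
    (2 * (CK * d ^+ m) * fundr rho 1)%:E * \int[leb]_(x in I01) `|restr a f x|%:E)%E.
Proof.
move=> rhoP mf d0 hd; apply: (kernel_op_upper m0 rhoP KerP).
- exact: measurable_restr.
- by rewrite mulr_gt0// exprn_gt0.
move=> j k t s t0 ts s1 gs; apply: (KerU rhoP d0 hd) => //.
(* [restr a f] vanishes from [a] on, so [g s != 0] forces [s < a]. *)
rewrite ltNge; apply/negP => as_; move/eqP: gs; apply.
by rewrite /restr indicE memNset ?mul0r//= in_itv /= (ltNge s) as_ andbF.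
Qed.

(** The test function for the lower bounds: [kernel_lower] applies on its support for every
    [t < a / 4], and [l] normalises it in L^1 or in X. *)
Definition bump (l a : R) : R -> R := fun x => l * \1_(`](a / 2), a[%classic) x.

Lemma measurable_bump l a : measurable_fun I01 (bump l a).
Proof. by apply: measurable_funM => //; exact: measurable_indic. Qed.

Lemma kernel_op_bump l a t : 0 <= l -> a < 1 -> 0 < t -> t < a / 4 ->
  ((l * (a / 2) * (cK * (a ^+ m.-1 / I a ^+ m)))%:E <=
     kernel_op Ker (restr a (bump l a)) t)%E.
Proof.
move=> l0 a1 t0 ta; have a0 : 0 < a by lra.
have t1 : t < 1 by lra.
rewrite /kernel_op t0 t1 /=; set g := restr a _; set c := cK * _.
have c0 : 0 <= c.
  by rewrite /c mulr_ge0 ?(ltW cK0)// divr_ge0 ?exprn_ge0// ltW// I0.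
have mg : measurable_fun I01 g by apply: measurable_restr; exact: measurable_bump.
have sub : `](a / 2), a[%classic `<=` `]t, 1[%classic.
  by move=> s /=; rewrite !in_itv /= => /andP[? ?]; apply/andP; split; lra.
apply: (@le_trans _ _ (\int[leb]_(s in `](a / 2)%R, a[) (`|g s|%:E * Ker t s))%E); last first.
  apply: ge0_subset_integral => //; first exact: kernel_integrand_measurable.
  by move=> s; exact: kernel_integrand_ge0.
apply: (@le_trans _ _ (\int[leb]_(s in `](a / 2)%R, a[) (l * c)%:E)%E).
  rewrite integral_cst// [X in (_ * X)%E]lebesgue_measure_itvE; last by lra.
  by rewrite -EFinM lee_fin le_eqVlt; apply/orP; left; apply/eqP; field.
apply: ge0_le_integral => //.
- by move=> s _; rewrite lee_fin mulr_ge0.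
- by apply: (measurable_funS _ sub) => //; exact: kernel_integrand_measurable.
move=> s sa; move: (sa); rewrite /= in_itv /= => /andP[as_ sa'].
have -> : `|g s| = l.
  rewrite /g /restr /bump !indicE (mem_set sa) mem_set /=; last first.
    by rewrite in_itv /=; apply/andP; split; lra.
  by rewrite mul1r mulr1 ger0_norm.
by rewrite EFinM; apply: lee_wpmul2l; [rewrite lee_fin|exact: KerL].
Qed.

Lemma norm_kernel_op_bump (rho : (R -> \bar R) -> \bar R) l a :
  lattice_norm rho -> 0 <= l -> 0 < a -> a < 1 ->
  ((l * (a / 2) * (cK * (a ^+ m.-1 / I a ^+ m)) * fundr rho (a / 4))%:E <=
     rho (kernel_op Ker (restr a (bump l a))))%E.
Proof.
move=> rhoP l0 a0 a1; set c := l * _ * _.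
have c0 : 0 <= c.
  rewrite /c !mulr_ge0 ?invr_ge0 ?(ltW cK0) ?(ltW a0) ?exprn_ge0 ?(ltW a0)//.
  by rewrite ltW// I0.
rewrite EFinM -(fundrE rhoP) -(ln_homog rhoP)//; last exact: mpos_indic.
apply: ln_le => //.
- by apply: mposZ => //; exact: mpos_indic.
- by apply: mpos_kernel_op => //; apply: measurable_restr; exact: measurable_bump.
move=> t /andP[t0 t1]; have [ta|at_] := ltP t (a / 4).
  by rewrite indicE mem_set ?mule1 /= ?in_itv /= ?t0//; exact: kernel_op_bump.
rewrite indicE memNset ?mule0; last by rewrite /= in_itv /= (ltNge t) at_ andbF.
have : mpos (kernel_op Ker (restr a (bump l a))).
  by apply: mpos_kernel_op => //; apply: measurable_restr; exact: measurable_bump.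
by case.
Qed.

Variable rho : (R -> \bar R) -> \bar R.
Hypothesis rhoP : ri_norm rho.
Let lnP : lattice_norm rho := ri_norm_lattice_norm rhoP.
Let L1P := @L1norm_lattice_norm R.

Local Notation TX := (sup_norm_restr (kernel_op Ker) rho (@L1ball R)).
Local Notation T1 := (sup_norm_restr (kernel_op Ker) (@L1norm R) (Xball rho)).
Local Notation W := (fund_ratio m I rho).

Let measurable0 : measurable_fun I01 (fun _ : R => 0 : R).
Proof. exact: measurable_cst. Qed.

Lemma L1ball0 : @L1ball R (fun=> 0).
Proof.
split => //; rewrite (_ : (\int[leb]_(x in I01) _)%E = 0%E) ?lee01//.
by apply: integral0_eq => x _; rewrite normr0.
Qed.

Lemma Xball0 : Xball rho (fun=> 0).
Proof.
split => //; rewrite (_ : (fun x => _) = (fun=> 0%E)) ?(ln0 lnP) ?lee01//.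
by apply/funext => x; rewrite normr0.
Qed.

Lemma TX_ge0 a : (0 <= TX a)%E.
Proof.
apply: (@le_trans _ _ (rho (kernel_op Ker (restr a (fun=> 0))))); last first.
  by apply: ereal_sup_ubound; exists (fun=> 0) => //; exact: L1ball0.
by apply: (ln_ge0 lnP); apply: mpos_kernel_op => //; exact: measurable_restr.
Qed.

Lemma T1_ge0 a : (0 <= T1 a)%E.
Proof.
apply: (@le_trans _ _ (L1norm (kernel_op Ker (restr a (fun=> 0))))); last first.
  by apply: ereal_sup_ubound; exists (fun=> 0) => //; exact: Xball0.
by apply: (ln_ge0 L1P); apply: mpos_kernel_op => //; exact: measurable_restr.
Qed.

Let WE a : W a = (a ^+ m.-1 / I a ^+ m * fundr rho a)%:E.
Proof. by rewrite /fund_ratio (fundrE lnP). Qed.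

Let aI0 a : 0 < a -> a < 1 -> 0 < a ^+ m.-1 / I a ^+ m.
Proof. by move=> a0 a1; rewrite divr_gt0 ?exprn_gt0// I0. Qed.

Lemma W_ge0 a : 0 < a < 1 -> (0 <= W a)%E.
Proof.
move=> /andP[a0 a1]; rewrite WE lee_fin mulr_ge0 ?(ltW (aI0 a0 a1))//.
by rewrite ltW// fundr_gt0.
Qed.

(** Forwards, test on the bump of L^1 norm 1, whose height is [2 / a]. Backwards, a bound on [W]
    cleared of its denominator is the condition of [norm_kernel_op_le]. *)
Lemma TX_cvgP : TX @ 0^'+ --> 0%E <-> W @ 0^'+ --> 0%E.
Proof.
have P0 := fundr_gt0 lnP (ltr01 : 0 < 1 :> R).
rewrite (cvg_at_right0P W_ge0) (cvg_at_right0P (fun a _ => TX_ge0 a)).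
split=> H e e0.
  (* The 4 anticipates the loss in [fundfun_quarter]. *)
  have e'0 : 0 < cK * e / 4 by rewrite divr_gt0// mulr_gt0.
  have [d /andP[d0 d1] hd] := H _ e'0; exists d; first by rewrite d0.
  move=> a /andP[a0 ad]; have a1 := lt_le_trans ad d1.
  have l0 : 0 <= 2 / a by rewrite divr_ge0// ltW.
  have h1 := norm_kernel_op_bump lnP l0 a0 a1.
  have h2 : (rho (kernel_op Ker (restr a (bump (2 / a) a))) <= TX a)%E.
    apply: ereal_sup_ubound; exists (bump (2 / a) a) => //; split; first exact: measurable_bump.
    rewrite (_ : (fun x => _) =
      fun x => (2 / a)%:E * (\1_(`](a / 2)%R, a[%classic) x)%:E)%E; last first.
      by apply/funext => x; rewrite /bump ger0_norm ?EFinM// mulr_ge0.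
    rewrite ge0_integralZl_EFin//; last by case: (@mpos_indic R `](a / 2), a[%classic).
    rewrite integral_indic// setIidl; last first.
      move=> x; rewrite /= in_itv /= => /andP[? ?]; apply/I01E; apply/andP; split; lra.
    rewrite [X in (_ * X)%E]lebesgue_measure_itvE; last by lra.
    rewrite -EFinM lee_fin le_eqVlt; apply/orP; left; apply/eqP; field.
    by rewrite gt_eqF.
  have := le_trans h1 (le_trans h2 (hd a _)); rewrite a0 ad => /(_ isT).
  rewrite WE !lee_fin => h3.
  have h4 := fundfun_quarter rhoP a0 (ltW a1).
  set x := a ^+ m.-1 / _ in h3 *; have x0 : 0 < x := aI0 a0 a1.
  have h5 : cK * (x * fundr rho (a / 4)) <= cK * (e / 4).
    apply: le_trans (le_trans h3 _); last by rewrite mulrA.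
    rewrite le_eqVlt; apply/orP; left; apply/eqP; field; by rewrite gt_eqF.
  rewrite ler_pM2l// in h5.
  apply: (@le_trans _ _ (x * (4 * fundr rho (a / 4)))); first by rewrite ler_pM2l.
  by lra.
(* Capping [d] at 1 gives [d ^+ m <= d], which replaces an m-th root of the tolerance. *)
pose d := Num.min 1 (e / (2 * CK * fundr rho 1)).
have D0 : 0 < 2 * CK * fundr rho 1 by rewrite !mulr_gt0.
have d0 : 0 < d by rewrite lt_min ltr01 divr_gt0.
have dm : d ^+ m <= e / (2 * CK * fundr rho 1).
  apply: (@le_trans _ _ d); last by rewrite ge_min lexx orbT.
  have d1 : d <= 1 by rewrite ge_min lexx.
  rewrite -(prednK m0) exprS ler_piMr ?(ltW d0)// exprn_ile1// ltW//.
have b0 : 0 < d ^+ m * fundr rho 1 by rewrite mulr_gt0// exprn_gt0.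
have [b /andP[b'0 b1] hb] := H _ b0; exists b; first by rewrite b'0.
move=> a /andP[a0 ab]; apply: ge_ereal_sup => _ [f [mf f1] <-].
have hs s : 0 < s -> s < a -> s < 1 ->
    s ^+ m.-1 * fundr rho s <= d ^+ m * fundr rho 1 * I s ^+ m.
  move=> s0 sa s1; have := hb s; rewrite s0 (lt_trans sa ab) => /(_ isT).
  by rewrite WE lee_fin mulrAC ler_pdivrMr// exprn_gt0// I0.
apply: (le_trans (norm_kernel_op_le lnP mf d0 hs)).
apply: (@le_trans _ _ ((2 * (CK * d ^+ m) * fundr rho 1)%:E * 1)%E).
  apply: lee_wpmul2l; first by rewrite lee_fin !mulr_ge0 ?exprn_ge0 ?(ltW CK0) ?(ltW d0) ?(ltW P0).
  by apply: le_trans f1; exact: integral_restr_le.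
rewrite mule1 lee_fin; move: dm; rewrite ler_pdivlMr//; apply: le_trans.
by rewrite le_eqVlt; apply/orP; left; apply/eqP; ring.
Qed.

Let fL r : 0 <= r <= 1 -> fundr (@L1norm R) r = r.
Proof. by move=> r01; rewrite /fundr fundfun_L1norm. Qed.

(** For [L1norm] the fundamental function is the identity, and the condition of [norm_kernel_op_le]
    is the m-th power of [s / I s <= d]. *)
Lemma L1norm_kernel_op_le f d a : measurable_fun I01 f -> 0 < d ->
  (forall s, 0 < s -> s < a -> s < 1 -> s / I s <= d) ->
  (L1norm (kernel_op Ker (restr a f)) <=
    (2 * CK * d ^+ m)%:E * \int[leb]_(x in I01) `|restr a f x|%:E)%E.
Proof.
move=> mf d0 hd.
have := @norm_kernel_op_le (@L1norm R) f d a L1P mf d0.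
rewrite (fL (r := 1)) ?ler01 ?lexx// !mulr1 mulrA; apply.
move=> s s0 sa s1; rewrite fL; last by rewrite !ltW.
rewrite mulrC -exprS prednK// -exprMn.
apply: lerXn2r; rewrite ?nnegrE ?(ltW s0)//.
  by rewrite mulr_ge0 ?(ltW d0)// ltW// I0.
by rewrite -ler_pdivrMr ?I0//; exact: hd.
Qed.

Lemma T1_cvg_of_small : (fun s => s / I s) @ 0^'+ --> 0 -> T1 @ 0^'+ --> 0%E.
Proof.
have sI s : 0 < s < 1 -> 0 <= s / I s.
  by move=> /andP[s0 s1]; rewrite divr_ge0 ?ltW// I0.
rewrite cvgr_at_right0P// cvg_at_right0P; last by move=> a _; exact: T1_ge0.
move=> H e e0; have [C hC] := ri_L1 rhoP.
(* [ri_L1] does not assert that [C] is positive. *)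
pose C1 := Num.max 1 C.
have C10 : 0 < C1 by rewrite lt_max ltr01.
pose d := Num.min 1 (e / (2 * CK * C1)).
have D0 : 0 < 2 * CK * C1 by rewrite !mulr_gt0.
have d0 : 0 < d by rewrite lt_min ltr01 divr_gt0.
have dm : d ^+ m <= e / (2 * CK * C1).
  apply: (@le_trans _ _ d); last by rewrite ge_min lexx orbT.
  have d1 : d <= 1 by rewrite ge_min lexx.
  rewrite -(prednK m0) exprS ler_piMr ?(ltW d0)// exprn_ile1// ltW//.
have [b /andP[b'0 b1] hb] := H _ d0; exists b; first by rewrite b'0.
move=> a /andP[a0 ab]; apply: ge_ereal_sup => _ [f [mf f1] <-].
apply: (le_trans (L1norm_kernel_op_le (a := a) mf d0 _)).
  by move=> s s0 sa s1; apply: hb; rewrite s0 (lt_trans sa).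
apply: (@le_trans _ _ ((2 * CK * d ^+ m)%:E * C1%:E)%E).
  apply: lee_wpmul2l; first by rewrite lee_fin !mulr_ge0 ?exprn_ge0 ?(ltW CK0) ?(ltW d0).
  apply: (le_trans (integral_restr_le a mf)); apply: (le_trans (hC _ (mpos_abs mf))).
  have r0 : (0 <= rho (fun x => `|f x|%:E))%E by apply: (ri_ge0 rhoP); exact: mpos_abs.
  apply: (@le_trans _ _ (C1%:E * rho (fun x => `|f x|%:E))%E).
    by apply: lee_wpmul2r => //; rewrite lee_fin le_max lexx orbT.
  by rewrite -[leRHS]mule1; apply: lee_wpmul2l => //; rewrite lee_fin ltW.
rewrite -EFinM lee_fin; move: dm; rewrite ler_pdivlMr//; apply: le_trans.
by rewrite le_eqVlt; apply/orP; left; apply/eqP; ring.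
Qed.

(** Here [s / I s] is merely bounded by [c^-1]; the smallness comes from the integral of [|f|] over
    (0,a), uniformly on the unit ball of X. *)
Lemma T1_cvg_of_not_L1 (c : R) : 0 < c -> (forall t, 0 < t <= 1 -> c <= I t / t) ->
  ~ X_is_L1 rho -> T1 @ 0^'+ --> 0%E.
Proof.
move=> c0 hc nL1; rewrite cvg_at_right0P; last by move=> a _; exact: T1_ge0.
(* If this fails for [e], then [integral_le_fundr] forces [fundr rho d <= d / e] for every [d] in
   (0,1), and X is L^1. *)
have small e : 0 < e -> exists2 d, 0 < d <= 1 & forall a, 0 < a < d ->
    forall f, Xball rho f -> (\int[leb]_(x in I01) `|restr a f x|%:E <= e%:E)%E.
  move=> e0; apply: contrapT => H; apply: nL1.
  apply: (@X_is_L1_of_fundr _ _ rhoP e^-1); first by rewrite invr_ge0 ltW.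
  move=> d /andP[d0 d1]; apply: contrapT => /negP; rewrite -ltNge => hd.
  apply: H; exists d; first by rewrite d0 ltW.
  move=> a /andP[a0 ad] f [mf rf].
  have mf' : measurable_fun I01 (fun x => `|f x|) by exact: measurableT_comp.
  have := @integral_le_fundr _ _ _ d rhoP mf' (fun x => normr_ge0 _) d0 d1 rf.
  move=> h; apply: (@le_trans _ _ (d / fundr rho d)%:E).
    apply: le_trans h; apply: ge0_le_integral => //.
    - by case: (mpos_abs (measurable_restr a mf)).
    - apply/measurable_EFinP; apply: measurable_funM => //; exact: measurable_indic.
    move=> x _; rewrite lee_fin /restr normrM ler_wpM2r// !indicE.
    case: (boolP (x \in `]0, a[%classic)) => [/set_mem|_]; last by rewrite normr0.
    rewrite /= in_itv /= => /andP[x0 xa].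
    by rewrite normr1 mem_set//= in_itv /= x0 (lt_trans xa).
  have p0 : 0 < fundr rho d by exact: fundr_gt0.
  by rewrite lee_fin ler_pdivrMr// mulrC -ler_pdivrMr// mulrC ltW.
move=> e e0; pose D := 2 * CK * c^-1 ^+ m.
have D0 : 0 < D by rewrite !mulr_gt0// exprn_gt0// invr_gt0.
have eD0 : 0 < e / D by rewrite divr_gt0.
have [d d01 hd] := small _ eD0; exists d => // a /andP[a0 ad].
apply: ge_ereal_sup => _ [f Xf <-]; have [mf _] := Xf.
have ic0 : 0 < c^-1 by rewrite invr_gt0.
apply: (le_trans (L1norm_kernel_op_le (a := a) mf ic0 _)).
  move=> s s0 sa s1; rewrite -[s / I s]invrK lef_pV2 ?posrE ?invr_gt0 ?divr_gt0 ?I0//.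
  by rewrite invf_div; apply: hc; rewrite s0 ltW.
apply: (@le_trans _ _ (D%:E * (e / D)%:E)%E).
  apply: lee_wpmul2l; first by rewrite lee_fin ltW.
  by apply: hd => //; rewrite a0.
by rewrite -EFinM lee_fin mulrC divfK ?gt_eqF.
Qed.

(** The bump of height [(fundr rho a)^-1] lies in the unit ball of X. Its image has L^1 norm at
    least [cK / 8 * (a / I a) ^+ m * (a / fundr rho a)], and the last quotient is at least [C^-1]
    when X is L^1. *)
Lemma small_of_T1_cvg : X_is_L1 rho -> T1 @ 0^'+ --> 0%E ->
  (fun s => s / I s) @ 0^'+ --> 0.
Proof.
have sI s : 0 < s < 1 -> 0 <= s / I s.
  by move=> /andP[s0 s1]; rewrite divr_ge0 ?ltW// I0.
move=> /(fundr_of_X_is_L1 rhoP)[C C0 hC].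
rewrite cvgr_at_right0P// cvg_at_right0P; last by move=> a _; exact: T1_ge0.
move=> H e e0; have e'0 : 0 < cK * e ^+ m / (8 * C) by rewrite divr_gt0 ?mulr_gt0 ?exprn_gt0.
have [d /andP[d0 d1] hd] := H _ e'0; exists d; first by rewrite d0.
move=> a /andP[a0 ad]; have a1 := lt_le_trans ad d1.
have p0 : 0 < fundr rho a by exact: fundr_gt0.
have l0 : 0 <= (fundr rho a)^-1 by rewrite invr_ge0 ltW.
have h1 := norm_kernel_op_bump L1P l0 a0 a1.
have h2 : (L1norm (kernel_op Ker (restr a (bump (fundr rho a)^-1 a))) <= T1 a)%E.
  apply: ereal_sup_ubound; exists (bump (fundr rho a)^-1 a) => //; split.
    exact: measurable_bump.
  rewrite (_ : (fun x => _) =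
    fun x => ((fundr rho a)^-1)%:E * (\1_(`](a / 2)%R, a[%classic) x)%:E)%E; last first.
    by apply/funext => x; rewrite /bump ger0_norm ?EFinM// mulr_ge0.
  rewrite (ln_homog lnP)//; last exact: mpos_indic.
  apply: (@le_trans _ _ (((fundr rho a)^-1)%:E * fundfun rho a)%E).
    apply: lee_wpmul2l; first by rewrite lee_fin.
    apply: ln_le => //; try exact: mpos_indic.
    move=> x _; rewrite lee_fin !indicE ler_nat.
    case: (boolP (x \in `](a / 2), a[%classic)) => // /set_mem.
    rewrite /= in_itv /= => /andP[? ?]; rewrite mem_set//= in_itv /=.
    by apply/andP; split; lra.
  by rewrite (fundrE lnP) -EFinM mulVf ?gt_eqF.
have := le_trans h1 (le_trans h2 (hd a _)); rewrite a0 ad => /(_ isT).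
rewrite lee_fin fL; last by apply/andP; split; lra.
have -> : (fundr rho a)^-1 * (a / 2) * (cK * (a ^+ m.-1 / I a ^+ m)) * (a / 4)
   = cK / 8 * (a / I a) ^+ m * (a / fundr rho a).
  have -> : (a / I a) ^+ m = a * a ^+ m.-1 / I a ^+ m.
    by rewrite -exprS prednK// exprMn exprVn.
  field; rewrite expf_neq0 ?gt_eqF// I0//.
move=> h3.
have h4 : C^-1 <= a / fundr rho a.
  rewrite -[leRHS]invrK lef_pV2 ?posrE ?invr_gt0 ?divr_gt0//.
  by rewrite invf_div ler_pdivrMr//; apply: hC; rewrite a0.
have x0 : 0 <= a / I a by apply: sI; rewrite a0.
have h5 : cK / 8 * (a / I a) ^+ m * C^-1 <= cK * e ^+ m / (8 * C).
  apply: le_trans h3; apply: ler_wpM2l => //.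
  by rewrite mulr_ge0 ?exprn_ge0// divr_ge0// ltW.
have h6 : (a / I a) ^+ m <= e ^+ m.
  have k0 : 0 < cK / 8 * C^-1 by rewrite !mulr_gt0 ?invr_gt0.
  rewrite -(ler_pM2l k0); apply: le_trans (le_trans h5 _).
    by rewrite mulrAC.
  rewrite le_eqVlt; apply/orP; left; apply/eqP; field; by rewrite gt_eqF.
by move: h6; rewrite ler_pXn2r// ?nnegrE// ltW.
Qed.

End MainEstimates.

Lemma sup_norm_restr_Hop (R : realType) (m : nat) (I : R -> R)
    (N : (R -> \bar R) -> \bar R) (B : set (R -> R)) :
  (forall t, 0 < t <= 1 -> 0 < I t) ->
  (forall s t, 0 < s -> s <= t -> t <= 1 -> I s <= I t) ->
  (forall f, B f -> measurable_fun (@I01 R) f) ->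
  sup_norm_restr (Hop m I) N B = sup_norm_restr (kernel_op (kernelH m I)) N B.
Proof.
move=> I_gt0 I_nd mB; apply/funext => a; congr ereal_sup; apply: eq_imagel => f Bf.
by rewrite HopE//; apply: measurable_restr; exact: mB.
Qed.

Lemma sup_norm_restr_Kop (R : realType) (m : nat) (I : R -> R)
    (N : (R -> \bar R) -> \bar R) (B : set (R -> R)) :
  sup_norm_restr (Kop m I) N B = sup_norm_restr (kernel_op (kernelK m I)) N B.
Proof.
by apply/funext => a; congr ereal_sup; apply: eq_imagel => f Bf; rewrite KopE.
Qed.
Unset Implicit Arguments.

Theorem theorem7p1 (R : realType) (m : nat) (I : R -> R)
  (rho : (R -> \bar R) -> \bar R) :
  (0 < m)%N ->
  (forall t, 0 < t <= 1 -> 0 < I t) ->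
  (forall s t, 0 < s -> s <= t -> t <= 1 -> I s <= I t) ->
  (exists2 c : R, 0 < c & forall t, 0 < t <= 1 -> c <= I t / t) ->
  ri_norm rho ->
  let HX := fun a : R => ereal_sup
      [set rho (Hop m I (restr a f)) | f in @L1ball R] in
  let KX := fun a : R => ereal_sup
      [set rho (Kop m I (restr a f)) | f in @L1ball R] in
  let H1 := fun a : R => ereal_sup
      [set L1norm (Hop m I (restr a f)) | f in Xball rho] in
  let K1 := fun a : R => ereal_sup
      [set L1norm (Kop m I (restr a f)) | f in Xball rho] in
  (* part (a) *)
  ((HX @ 0^'+ --> 0%E <-> KX @ 0^'+ --> 0%E) /\
   (KX @ 0^'+ --> 0%E <->
      (fun a : R => ((a ^+ m.-1 / (I a) ^+ m)%:E * fundfun rho a)%E)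
        @ 0^'+ --> 0%E)) /\
  (* part (b) *)
  ((H1 @ 0^'+ --> 0%E <-> K1 @ 0^'+ --> 0%E) /\
   (~ X_is_L1 rho -> H1 @ 0^'+ --> 0%E /\ K1 @ 0^'+ --> 0%E) /\
   (X_is_L1 rho ->
      ((H1 @ 0^'+ --> 0%E /\ K1 @ 0^'+ --> 0%E) <->
       (fun s : R => s / I s) @ 0^'+ --> 0))).
Proof.
move=> m0 I_gt0 I_nd [c c0 hc] rhoP HX KX H1 K1.
have mL1 f : @L1ball R f -> measurable_fun (@I01 R) f by case.
have mX f : Xball rho f -> measurable_fun (@I01 R) f by case.
have HXE : HX = sup_norm_restr (kernel_op (kernelH m I)) rho (@L1ball R).
  exact: (sup_norm_restr_Hop m rho I_gt0 I_nd mL1).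
have KXE : KX = sup_norm_restr (kernel_op (kernelK m I)) rho (@L1ball R).
  exact: (sup_norm_restr_Kop m I rho (@L1ball R)).
have H1E : H1 = sup_norm_restr (kernel_op (kernelH m I)) (@L1norm R) (Xball rho).
  exact: (sup_norm_restr_Hop m (@L1norm R) I_gt0 I_nd mX).
have K1E : K1 = sup_norm_restr (kernel_op (kernelK m I)) (@L1norm R) (Xball rho).
  exact: (sup_norm_restr_Kop m I (@L1norm R) (Xball rho)).
have KP := kernelK_admissible m I_gt0 I_nd.
have HP := kernelH_admissible m I_gt0 I_nd.
have KU := kernelK_upper m0 I_gt0.
have HU := kernelH_upper m0 I_gt0 I_nd.
have KL := kernelK_lower m I_gt0 I_nd.
have HL := kernelH_lower m0 I_gt0 I_nd.
have CK0 : 0 < 2 ^+ m :> R by rewrite exprn_gt0.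
have CH0 : 0 < 2 * 2 ^+ (3 * m.-1) * 2 ^+ (m.-1 * m.-1) :> R.
  by rewrite !mulr_gt0 ?exprn_gt0.
have cK0 : 0 < 2^-1 ^+ m.-1 :> R by rewrite exprn_gt0 ?invr_gt0.
have cH0 : 0 < (m.-1)`!%:R^-1 * 4^-1 ^+ m.-1 :> R.
  by rewrite mulr_gt0 ?exprn_gt0 ?invr_gt0// ltr0n fact_gt0.
have aH := TX_cvgP m0 I_gt0 HP CH0 cH0 HU HL rhoP.
have aK := TX_cvgP m0 I_gt0 KP CK0 cK0 KU KL rhoP.
have nH := T1_cvg_of_not_L1 m0 I_gt0 HP CH0 HU rhoP c0 hc.
have nK := T1_cvg_of_not_L1 m0 I_gt0 KP CK0 KU rhoP c0 hc.
have sH := T1_cvg_of_small m0 I_gt0 HP CH0 HU rhoP.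
have sK := T1_cvg_of_small m0 I_gt0 KP CK0 KU rhoP.
have lH := small_of_T1_cvg m0 I_gt0 HP cH0 HL rhoP.
have lK := small_of_T1_cvg m0 I_gt0 KP cK0 KL rhoP.
(* Forgetting the bodies lets the four suprema be replaced by their kernel forms. *)
clearbody HX KX H1 K1; subst HX KX H1 K1; split.
  by split; [exact: (iff_trans aH (iff_sym aK))|exact: aK].
(* The two limits of (b) are compared by cases: if X is L^1, each is equivalent to the limit of
   [s / I s]; otherwise both hold. *)
split; first by split=> h; have [L|L] := pselect (X_is_L1 rho);
  [exact/sK/lH|exact: nK|exact/sH/lK|exact: nH].
split=> [L|L]; first by split; [exact: nH|exact: nK].
by split=> [[h _]|h]; [exact: lH|split; [exact: sH|exact: sK]].
Qed.
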